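(* Let $M$ be a smooth manifold with a regular (constant-rank), non-integrable distribution $Q$. Let $c:I=[a,b]\to M$ be an immersed curve tangent to $Q$ which is an integral curve of a vector field $X\in\Gamma(Q)$, defined on a neighbourhood of $\operatorname{Im}(c)$, with local flow $\{\phi_s\}$. Then $c$ is an abnormal extremal if and only if there exists a nowhere vanishing section $\eta$ of $Q^0$, defined along $c$, such that $\eta(t)=T^*\phi_{-(t-a)}(\eta(a))$ for all $t\in I$.
   Context: All manifolds are real, Hausdorff, second countable and $C^\infty$. A curve is a smooth map from a closed interval admitting a smooth extension to an open interval; it is tangent to $Q$ if $\dot c(t)\in Q_{c(t)}$ for all $t$. $Q^0\subset T^*M$ is the annihilator of $Q$. The flow satisfies $\phi_s(c(t))=c(t+s)$. For $\alpha\in T^*_{\phi_s(x)}M$, $T^*\phi_s(\alpha)\in T^*_xM$ is defined by $T^*\phi_s(\alpha)(Y_x)=\alpha(T\phi_s(Y_x))$ for $Y_x\in T_xM$. For $\eta_x\in Q^0_x$, $X_x\in Q_x$ and a vector field $Y$ on $M$, put $\langle\eta_x,[X_x,Y]\rangle:=\langle\eta,[X,Y]\rangle(x)$ for any local sections $\eta$ of $Q^0$ and $X$ of $Q$ extending $\eta_x,X_x$ (independent of choices). A continuous piecewise smooth curve $c$ tangent to $Q$ is an abnormal extremal if there is a continuous piecewise smooth curve $\psi$ in $T^*M$ along $c$ (i.e. $\psi(t)\in T^*_{c(t)}M$), not meeting the zero section, with $\psi(t)\in Q^0$ for all $t$ and $\frac{d}{dt}\langle\psi(t),Y(c(t))\rangle=\langle\psi(t),[\dot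 c(t),Y]\rangle$ for all vector fields $Y$ on $M$ and all $t$ where $\dot c(t)$ is defined. *)

(* Defs.v *)
From HB Require Import structures.
From mathcomp Require Import all_boot all_order all_algebra.
From mathcomp Require Import all_classical all_reals all_analysis.

Set Implicit Arguments.
Unset Strict Implicit.
Unset Printing Implicit Defensive.

Import Order.TTheory GRing.Theory Num.Theory.
Import numFieldNormedType.Exports.

Local Open Scope classical_set_scope.
Local Open Scope ring_scope.

Section Smooth.
Context {R : realType} {V W : normedModType R}.

(* For an open set A of a finite-dimensional V: f is C^(k+1) on A iff it is
   differentiable on A and all its directional derivatives are C^k on A. *)
Fixpoint Ck (k : nat) (A : set V) (f : V -> W) : Prop :=
  match k with
  | 0%N => forall x, A x -> {for x, continuous f}
  | k'.+1 => (forall x, A x -> differentiable f x) /\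
             forall v, Ck k' A (fun x => ('d f x : V -> W) v)
  end.

Definition smooth (A : set V) (f : V -> W) : Prop := forall k, Ck k A f.

End Smooth.

(* A smooth n-manifold without boundary, given by an atlas indexed by
   [chart_index].  The maps [cmap] and [cinv] are total; only [cmap i] on
   [cdom i] and [cinv i] on the image of [cdom i] are meaningful. *)
Record manifold (R : realType) (n : nat) := Manifold {
  carrier :> topologicalType;
  carrier_hausdorff : hausdorff_space carrier;
  carrier_second_countable : @second_countable carrier;
  chart_index : Type;
  cdom : chart_index -> set carrier;
  cmap : chart_index -> carrier -> 'rV[R]_n;
  cinv : chart_index -> 'rV[R]_n -> carrier;
  cdom_open : forall i, open (cdom i);
  cimg_open : forall i, open (cmap i @` cdom i);
  cmapK : forall i x, cdom i x -> cinv i (cmap i x) = x;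
  cmap_continuous : forall i x, cdom i x -> {for x, continuous (cmap i)};
  cinv_continuous : forall i y, (cmap i @` cdom i) y ->
    {for y, continuous (cinv i)};
  cdom_cover : forall x, exists i, cdom i x;
  chart_compat : forall i j,
    smooth (cmap i @` (cdom i `&` cdom j)) (cmap j \o cinv i)
}.

Section Geometry.
Context {R : realType} {n : nat} {M : manifold R n}.
Implicit Types (x : M) (i : chart_index M).

Definition chart_at x : chart_index M := projT1 (cid (cdom_cover x)).

(* Tangent vectors at x are represented by their coordinates, in 'rV[R]_n, with
   respect to the chart [chart_at x], and covectors at x by column vectors, the
   dual coordinates with respect to the same chart.  A vector field is thus a
   function M -> 'rV[R]_n; it is compared with smooth structures only after the
   change of coordinates [chart_coord] to a fixed chart. *)

Definition pairing (eta : 'cV[R]_n) (v : 'rV[R]_n) : R := (v *m eta) 0 0.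

Definition chart_coord i x (v : 'rV[R]_n) : 'rV[R]_n :=
  'd (cmap i \o cinv (chart_at x)) (cmap (chart_at x) x) v.

(* The j-th coordinate of a covector in the chart i is its value on the j-th
   coordinate vector field of i at x. *)
Definition chart_cocoord i x (eta : 'cV[R]_n) : 'cV[R]_n :=
  \col_j pairing eta
    ('d (cmap (chart_at x) \o cinv i) (cmap i x) (delta_mx 0 j : 'rV[R]_n)).

(* A is meant to be open. *)
Definition smooth_map {V : normedModType R} (A : set V) (f : V -> M) : Prop :=
  (forall p, A p -> {for p, continuous f}) /\
  forall i, smooth (A `&` f @^-1` cdom i) (cmap i \o f).

Definition tangent_map (f : M -> M) x (v : 'rV[R]_n) : 'rV[R]_n :=
  'd (cmap (chart_at (f x)) \o f \o cinv (chart_at x)) (cmap (chart_at x) x) v.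

(* For alpha a covector at f x, the covector Y |-> alpha (Tf Y) at x. *)
Definition cotangent_map (f : M -> M) x (alpha : 'cV[R]_n) : 'cV[R]_n :=
  \col_j pairing alpha (tangent_map f x (delta_mx 0 j)).

Definition local_rep i (X : M -> 'rV[R]_n) (y : 'rV[R]_n) : 'rV[R]_n :=
  chart_coord i (cinv i y) (X (cinv i y)).

Definition smooth_vector_field (U : set M) (X : M -> 'rV[R]_n) : Prop :=
  forall i, smooth (cmap i @` (cdom i `&` U)) (local_rep i X).

(* [X, Y]^i = X^j d_j Y^i - Y^j d_j X^i *)
Definition lie_bracket (X Y : M -> 'rV[R]_n) x : 'rV[R]_n :=
  let i := chart_at x in
  let p := cmap i x in
  'd (local_rep i Y) p (local_rep i X p) - 'd (local_rep i X) p (local_rep i Y p).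

Definition regular_distribution (k : nat) (Q : M -> {vspace 'rV[R]_n}) : Prop :=
  forall x, exists U : set M, exists X : 'I_k -> M -> 'rV[R]_n,
    [/\ open U, U x, forall j, smooth_vector_field U (X j) &
        forall y, U y ->
          \dim (Q y) = k /\ Q y = <<[seq X j y | j : 'I_k]>>%VS].

Definition section_of (Q : M -> {vspace 'rV[R]_n}) (U : set M)
    (X : M -> 'rV[R]_n) : Prop :=
  smooth_vector_field U X /\ forall y, U y -> X y \in Q y.

(* Every point lies on an integral manifold of Q, given here by a
   parametrization f of an open piece of it.  That f is an immersion follows
   from the equality of its tangent spaces with the k-dimensional fibres of Q. *)
Definition integrable_distribution (k : nat)
    (Q : M -> {vspace 'rV[R]_n}) : Prop :=
  forall x, exists A : set 'rV[R]_k, exists f : 'rV[R]_k -> M,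
    [/\ open A, smooth_map A f, {in A &, injective f}, (f @` A) x &
        forall p, A p -> forall v, v \in Q (f p) <->
          exists w : 'rV[R]_k, 'd (cmap (chart_at (f p)) \o f) p w = v].

Definition annihilates (Q : M -> {vspace 'rV[R]_n}) x (eta : 'cV[R]_n) : Prop :=
  forall v, v \in Q x -> pairing eta v = 0.

(* One-sided at the end points when J is a closed interval. *)
Definition has_derivative {W : normedModType R} (J : set R) (g : R -> W)
    (t : R) (v : W) : Prop :=
  (s - t)^-1 *: (g s - g t) @[s --> within J t^'] --> v.

Definition has_velocity (J : set R) (c : R -> M) (t : R) (v : 'rV[R]_n) : Prop :=
  c s @[s --> within J (nbhs t)] --> c t /\
  has_derivative J (cmap (chart_at (c t)) \o c) t v.

Definition smooth_curve (a b : R) (c : R -> M) : Prop :=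
  exists2 e : R, 0 < e & exists2 c' : R -> M,
    smooth_map `]a - e, b + e[ c' & {in `[a, b], c' =1 c}.

(* The curve t |-> (c t, psi t) in T^*M, psi t being a covector at c t, is
   smooth in the charts of T^*M induced by those of M. *)
Definition smooth_cotangent (A : set R) (c : R -> M) (psi : R -> 'cV[R]_n) : Prop :=
  smooth_map A c /\
  forall i, smooth (A `&` c @^-1` cdom i) (fun t => chart_cocoord i (c t) (psi t)).

Definition smooth_cotangent_curve (c : R -> M) (psi : R -> 'cV[R]_n) (a b : R) :
    Prop :=
  exists2 e : R, 0 < e & exists c' : R -> M, exists psi' : R -> 'cV[R]_n,
    [/\ smooth_cotangent `]a - e, b + e[ c' psi',
        {in `[a, b], c' =1 c} & {in `[a, b], psi' =1 psi}].

(* P holds on each closed interval of some subdivision a = s_0 < ... < s_m = b.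
   For P a smoothness condition on the closed intervals, which share their end
   points, this includes continuity on [a, b]. *)
Definition piecewise (P : R -> R -> Prop) (a b : R) : Prop :=
  exists2 s : seq R, itv_partition a b s &
    forall j, (j < size s)%N -> P (nth b (a :: s) j) (nth b s j).

Definition tangent_to (Q : M -> {vspace 'rV[R]_n}) (a b : R) (c : R -> M) : Prop :=
  forall t v, t \in `[a, b] -> has_velocity `[a, b] c t v -> v \in Q (c t).

(* <eta, [v, Y]> for eta in the annihilator of Q x and v in Q x: the value at x
   of <eta, [X, Y]>, where X is a local section of Q through v.  It does not
   depend on X, and depends on an extension of eta only through eta itself. *)
Definition bracket_pairing (Q : M -> {vspace 'rV[R]_n}) x (eta : 'cV[R]_n)
    (v : 'rV[R]_n) (Y : M -> 'rV[R]_n) : R :=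
  xget 0 [set r | exists U : set M, exists X : M -> 'rV[R]_n,
    [/\ open U, U x, section_of Q U X, X x = v &
        r = pairing eta (lie_bracket X Y x)]].

Definition abnormal_extremal (Q : M -> {vspace 'rV[R]_n}) (a b : R)
    (c : R -> M) : Prop :=
  [/\ piecewise (fun s t => smooth_curve s t c) a b,
      tangent_to Q a b c &
      exists psi : R -> 'cV[R]_n,
        [/\ piecewise (smooth_cotangent_curve c psi) a b,
            forall t, t \in `[a, b] -> psi t != 0,
            forall t, t \in `[a, b] -> annihilates Q (c t) (psi t) &
            forall Y, smooth_vector_field setT Y ->
            forall t v, t \in `[a, b] -> has_velocity `[a, b] c t v ->
              has_derivative `[a, b] (fun s => pairing (psi s) (Y (c s))) t
                (bracket_pairing Q (c t) (psi t) v Y)]].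

Definition integral_curve (U : set M) (X : M -> 'rV[R]_n) (J : set R)
    (c : R -> M) : Prop :=
  forall t, J t -> U (c t) /\ has_velocity J c t (X (c t)).

(* phi, with domain D, is the local flow of the vector field X on the open set
   U: phi^~ x is the integral curve of X starting at x of which every other one
   is a restriction, and phi is smooth on D, which is open. *)
Definition local_flow (U : set M) (X : M -> 'rV[R]_n) (D : set (R * M))
    (phi : R -> M -> M) : Prop :=
  [/\ open D /\ (forall s x, D (s, x) -> U x),
      forall x, U x ->
        [/\ is_interval [set s | D (s, x)], D (0, x), phi 0 x = x &
            integral_curve U X [set s | D (s, x)] (phi^~ x)],
      forall x (J : set R) (c : R -> M), U x -> is_interval J -> J 0 ->
        c 0 = x -> integral_curve U X J c ->
        forall s, J s -> D (s, x) /\ c s = phi s x &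
      forall i, smooth_map
        [set p : R * 'rV[R]_n | (cmap i @` cdom i) p.2 /\ D (p.1, cinv i p.2)]
        (fun p : R * 'rV[R]_n => phi p.1 (cinv i p.2))].

End Geometry.

(* Main.v *)
(** The flow transports tangent vectors along c, and s |-> T phi_(s-t) v has
    derivative DX v at s = t in the chart at c(t), by the symmetry of the second
    derivatives of the flow.  In that chart the equation of an abnormal
    multiplier psi is the adjoint equation psi' = - psi o DX: one implication
    is the Leibniz rule, the other is obtained by testing the equation on
    vector fields Y = f e_j with f a bump function.  The adjoint equation at t
    says that s |-> <psi(s), T phi_(s-t) v> has derivative 0 at t.  Hence a
    multiplier pairs to a constant with every flow-invariant vector field
    along c, which means that it is invariant under the flow, and
    conversely. *)
Require Import Defs.
From HB Require Import structures.
From mathcomp Require Import all_boot all_order all_algebra.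
From mathcomp Require Import all_classical all_reals all_analysis.
From mathcomp Require Import ring lra.

Set Implicit Arguments.
Unset Strict Implicit.
Unset Printing Implicit Defensive.

Import Order.TTheory GRing.Theory Num.Theory.
Import numFieldNormedType.Exports.

Local Open Scope classical_set_scope.
Local Open Scope ring_scope.

(** * Differentials and C^k maps *)

Section Differential.
Context {R : realType}.
Implicit Types U V W : normedModType R.

(** Tangent vectors and covectors are stored in a chart chosen at their base point, and this chart
    jumps along c. Every derivative at time t is therefore taken in the single chart at c(t), and
    different times are compared only through numbers that depend on no chart, such as <psi(t), T
    phi_(t-T) v>; the mean value theorem makes them constant. Derivatives along c are limits within
    [a, b], one-sided at the end points, which calls for a small calculus of its own.

    The number <psi, [X, Y]> is defined by an arbitrary section of Q through the velocity. To
    compute with X itself, one needs that two sections of Q with the same value at x have first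
    derivatives that agree modulo the kernel of every covector in Q^0.

    The multiplier is accessible only through its pairings with vector fields on all of M, so the
    differentiability of its components has to be extracted from the equation, at every t of [a, b].
    Conversely, the smoothness of an invariant covector field, on an open interval around [a, b], is
    read off the flow, whose domain is open. *)

Lemma near_eq_is_diff V W (f g : V -> W) (x : V) :
  (\forall y \near x, f y = g y) -> differentiable f x -> is_diff x g ('d f x).
Proof.
move=> fg df; have fgx := nbhs_singleton fg.
have dg : g \o shift x = cst (g x) + 'd f x +o_0 id.
  apply/eqaddoP => _/posnumP[e].
  have /eqaddoP/(_ e%:num [gt0 of e%:num]) := diff_locally df.
  apply: filter_app; move: fg; rewrite (near_shift 0) /= => fg.
  by apply: filterS fg => y; rewrite /= subr0 => fgy;
    rewrite /= !fctE /= -fgy /cst fgx.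
have dE : 'd g x = 'd f x :> (V -> W).
  by apply: diff_unique => //; exact: diff_continuous.
apply: DiffDef => //; apply/diff_locallyP; rewrite dE; split => //.
exact: diff_continuous.
Qed.

Lemma near_eq_differentiable V W (f g : V -> W) (x : V) :
  (\forall y \near x, f y = g y) -> differentiable f x -> differentiable g x.
Proof. by move=> fg /(near_eq_is_diff fg)[]. Qed.

Lemma near_eq_diff V W (f g : V -> W) (x : V) :
  (\forall y \near x, f y = g y) -> differentiable f x ->
  'd g x = 'd f x :> (V -> W).
Proof. by move=> fg /(near_eq_is_diff fg)[]. Qed.

Lemma is_diff_linear V W (f : {linear V -> W}) (x : V) :
  continuous f -> is_diff x f f.
Proof.
by move=> cf; apply: DiffDef; [exact: linear_differentiable|exact: diff_lin].
Qed.

Lemma is_diff_real (f : R -> R) (x d : R) :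
  is_derive x 1 f d -> is_diff x f (fun h => h * d).
Proof.
move=> [df fd]; have dfx : differentiable f x by exact/derivable1_diffP.
apply: DiffDef => //; rewrite (deriv1E df) derive1E fd.
by apply/funext => h.
Qed.

(** With this instance scaling falls under the differential of a bilinear map, which yields the
    Leibniz rule [is_diff_scale]. *)
Lemma scale_is_bilinear W :
  bilinear_for
    (GRing.Scale.Law.clone _ _ *:%R _) (GRing.Scale.Law.clone _ _ *:%R _)
    (@GRing.scale R W).
Proof.
split=> [u'|u] a x y /=.
- by rewrite scalerDl scalerA.
- by rewrite scalerDr !scalerA mulrC.
Qed.
HB.instance Definition _ W := bilinear_isBilinear.Build R R W W _ _
  (@GRing.scale R W) (@scale_is_bilinear W).

Lemma is_diff_scale V W (k dk : V -> R) (f df : V -> W) (x : V) :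
  is_diff x k dk -> is_diff x f df ->
  is_diff x (fun z => k z *: f z) (fun v => k x *: df v + dk v *: f x).
Proof.
move=> dkx dfx.
have sc : continuous (fun p : R * W => p.1 *: p.2) by move=> p;
  exact: scale_continuous.
have ds : is_diff (k x, f x) (fun p : R * W => p.1 *: p.2)
    (fun q : R * W => k x *: q.2 + q.1 *: f x).
  apply: DiffDef; first exact: (@differentiable_bilin _ R W W (@GRing.scale R
    W)).
  exact: (@diff_bilin _ R W W (@GRing.scale R W) (k x, f x)).
have := is_diff_comp (is_diff_pair dkx dfx) ds.
by [].
Qed.

End Differential.

Section Smoothness.
Context {R : realType}.
Implicit Types U V W : normedModType R.

(** Continuity, differentiability and the differential at [x] depend on the germ of [f] at [x] and
    not on [A], so [Ck] is a conjunction over points and makes sense on a singleton. Restriction to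
    subsets and gluing over covers follow. *)
Lemma CkP V W k (A : set V) (f : V -> W) :
  Ck k A f <-> forall x, A x -> Ck k [set x] f.
Proof.
elim: k f => [|k IH] f /=.
  by split=> [H x Ax _ ->|H x Ax]; [exact: H|exact: H Ax _ _].
split=> [[df H] x Ax|H].
  by split=> [_ ->|v]; [exact: df|exact: (IH _).1].
split=> [x Ax|v]; first exact: (H x Ax).1.
by apply/IH => x Ax; exact: (H x Ax).2.
Qed.

Lemma Ck_sub V W k (A B : set V) (f : V -> W) : B `<=` A -> Ck k A f ->
  Ck k B f.
Proof. by move=> BA /CkP H; apply/CkP => x /BA; exact: H. Qed.

Lemma Ck_ext V W k (A : set V) (f g : V -> W) :
  open A -> (forall x, A x -> f x = g x) -> Ck k A f -> Ck k A g.
Proof.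
move=> oA; elim: k f g => [|k IH] f g fg /=.
  move=> cf x Ax; have fx : f @ x --> f x := cf x Ax.
  rewrite /prop_for /continuous_at -fg //; apply: cvg_trans fx;
    apply: near_eq_cvg.
  by near=> y; rewrite fg //; near: y; exact: open_nbhs_nbhs.
have fgn x : A x -> \forall y \near x, f y = g y.
  by move=> Ax; near=> y; apply/fg; near: y; exact: open_nbhs_nbhs.
move=> [df H]; split=> [x Ax|v].
  exact: near_eq_differentiable (fgn _ Ax) (df _ Ax).
apply: IH (H v) => x Ax.
by rewrite (near_eq_diff (fgn _ Ax) (df _ Ax)).
Unshelve. all: by end_near. Qed.

Lemma CkS V W k (A : set V) (f : V -> W) : Ck k.+1 A f -> Ck k A f.
Proof.
elim: k f => [|k IH] f.
  by move=> [df _] x Ax; exact: differentiable_continuous (df _ Ax).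
by move=> [df H]; split=> // v; exact: IH.
Qed.

Lemma Ck_cst V W k (A : set V) (w : W) : Ck k A (cst w).
Proof.
elim: k w => [|k IH] w; first by move=> x _; exact: cvg_cst.
split=> [x _|v]; first exact: differentiable_cst.
rewrite (_ : (fun _ => _) = cst 0); first exact: IH.
by apply/funext => x; rewrite diff_cst.
Qed.

Lemma Ck_linear_comp V W U k (A : set V) (f : V -> W) (l : {linear W -> U}) :
  open A -> continuous l -> Ck k A f -> Ck k A (l \o f).
Proof.
move=> oA cl; elim: k f => [|k IH] f.
  by move=> cf x Ax; apply: continuous_comp (cf _ Ax) _; exact: cl.
move=> [df H]; split=> [x Ax|v].
  by apply: differentiable_comp (df _ Ax) _; exact: linear_differentiable.
apply: Ck_ext (IH _ (H v)) => // x Ax /=.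
have dl : differentiable l (f x) by exact: linear_differentiable.
by rewrite (diff_comp (df x Ax) dl) /= diff_lin.
Qed.

Lemma Ck_add V W k (A : set V) (f g : V -> W) :
  open A -> Ck k A f -> Ck k A g -> Ck k A (f + g).
Proof.
move=> oA; elim: k f g => [|k IH] f g.
  by move=> cf cg x Ax; apply: continuousD; [exact: cf|exact: cg].
move=> [df Hf] [dg Hg]; split=> [x Ax|v].
  by apply: differentiableD; [exact: df|exact: dg].
apply: Ck_ext (IH _ _ (Hf v) (Hg v)) => // x Ax.
by rewrite (diffD (df x Ax) (dg x Ax)).
Qed.

Lemma Ck_sum V W k (A : set V) (I : Type) (r : seq I) (f : I -> V -> W) :
  open A -> (forall i, Ck k A (f i)) -> Ck k A (fun x => \sum_(i <- r) f i x).
Proof.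
move=> oA H; elim: r => [|i r IH].
  by rewrite (_ : (fun _ => _) = cst 0) ?funeqE => [|x];
    [exact: Ck_cst|rewrite big_nil].
rewrite (_ : (fun _ => _) = f i + (fun x => \sum_(i <- r) f i x)); last first.
  by rewrite funeqE => x; rewrite big_cons.
exact: Ck_add.
Qed.

Lemma Ck_scale V W k (A : set V) (a : V -> R) (f : V -> W) :
  open A -> Ck k A a -> Ck k A f -> Ck k A (fun x => a x *: f x).
Proof.
move=> oA; elim: k a f => [|k IH] a f.
  by move=> ca cf x Ax; apply: cvgZ; [exact: ca|exact: cf].
move=> Ha Hf; have [da Ha'] := Ha; have [df Hf'] := Hf.
have D x (Ax : A x) :=
  is_diff_scale (differentiableP (da x Ax)) (differentiableP (df x Ax)).
split=> [x /D[]//|v].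
apply: Ck_ext (Ck_add oA (IH _ _ (CkS Ha) (Hf' v)) (IH _ _ (Ha' v) (CkS Hf)))
  => //.
by move=> x /D[_ ->].
Qed.

(* W is finite-dimensional.  Needed for the chain rule, because Ck only speaks
   of the derivatives in fixed directions. *)
Definition framed W := exists m (e : 'I_m -> W) (l : 'I_m -> {linear W -> R}),
  (forall i, continuous (l i)) /\ forall w, w = \sum_i l i w *: e i.

(** The outer direction ['d f x v] moves with [x]. Expanding it in the frame turns the derivative of
    [g \o f] into a sum of products of a coordinate of ['d f x v] and a derivative of [g] in the
    fixed direction [e i], composed with [f]; the induction applies to each factor. *)
Lemma Ck_comp V W U k (A : set V) (B : set W) (f : V -> W) (g : W -> U) :
  framed W -> open A -> (forall x, A x -> B (f x)) ->
  Ck k A f -> Ck k B g -> Ck k A (g \o f).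
Proof.
move=> [m [e [l [cl wE]]]] oA AB; elim: k f g AB => [|k IH] f g AB.
  move=> cf cg x Ax; apply: continuous_comp; first exact: cf.
  exact/cg/AB.
move=> Hf [dg Hg]; have [df Hf'] := Hf; split=> [x Ax|v].
  by apply: differentiable_comp; [exact: df|exact/dg/AB].
have := @Ck_sum V U k A _ (index_enum 'I_m)
  (fun i x => l i ('d f x v) *: 'd g (f x) (e i)) oA.
move=> H; apply: Ck_ext (H _) => //.
  move=> x Ax; rewrite (diff_comp (df x Ax) (dg _ (AB x Ax))) /=.
  by rewrite [in RHS](wE ('d f x v)) linear_sum; apply: eq_bigr => i _;
    rewrite linearZ.
move=> i; apply: Ck_scale => //.
  exact: (Ck_linear_comp oA (cl i) (Hf' v)).
exact: (IH f (fun y => 'd g y (e i)) AB (CkS Hf) (Hg _)).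
Qed.

Lemma smooth_ext V W (A : set V) (f g : V -> W) :
  open A -> (forall x, A x -> f x = g x) -> smooth A f -> smooth A g.
Proof. by move=> oA fg sf k; exact: Ck_ext (sf k). Qed.

Lemma smooth_sub V W (A B : set V) (f : V -> W) :
  B `<=` A -> smooth A f -> smooth B f.
Proof. by move=> BA sf k; exact: Ck_sub (sf k). Qed.

Lemma smooth_cover V W (A : set V) (f : V -> W) :
  (forall x, A x -> exists2 B : set V, B x & smooth B f) -> smooth A f.
Proof.
move=> H k; apply/CkP => x /H[B Bx sf].
by apply: Ck_sub (sf k) => _ ->.
Qed.

Lemma smooth_comp V W U (A : set V) (B : set W) (f : V -> W) (g : W -> U) :
  framed W -> open A -> (forall x, A x -> B (f x)) ->
  smooth A f -> smooth B g -> smooth A (g \o f).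
Proof. by move=> fW oA AB sf sg k; exact: Ck_comp (sf k) (sg k). Qed.

Lemma smooth_diff V W (A : set V) (f : V -> W) v :
  smooth A f -> smooth A (fun x => 'd f x v).
Proof. by move=> sf k; exact: (sf k.+1).2. Qed.

Lemma smooth_differentiable V W (A : set V) (f : V -> W) x :
  smooth A f -> A x -> differentiable f x.
Proof. by move=> sf; exact: (sf 1).1. Qed.

Lemma smooth_linear V W (A : set V) (l : {linear V -> W}) :
  continuous l -> smooth A l.
Proof.
move=> cl [|k]; first by move=> x _; exact: cl.
split=> [x _|v]; first exact: linear_differentiable.
rewrite (_ : (fun _ => _) = cst (l v)); first exact: Ck_cst.
by apply/funext => x; rewrite diff_lin.
Qed.

Lemma smooth_cst V W (A : set V) (w : W) : smooth A (cst w).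
Proof. by move=> k; exact: Ck_cst. Qed.

Lemma smooth_add V W (A : set V) (f g : V -> W) :
  open A -> smooth A f -> smooth A g -> smooth A (f + g).
Proof. by move=> oA sf sg k; exact: Ck_add. Qed.

Lemma smooth_scale V W (A : set V) (a : V -> R) (f : V -> W) :
  open A -> smooth A a -> smooth A f -> smooth A (fun x => a x *: f x).
Proof. by move=> oA sf sg k; exact: Ck_scale. Qed.

Lemma smoothB V W (A : set V) (f g : V -> W) :
  open A -> smooth A f -> smooth A g -> smooth A (fun x => f x - g x).
Proof.
move=> oA sf sg; rewrite (_ : (fun _ => _) = f + (fun x => (-1 : R) *: g x)).
  by apply: smooth_add => //; apply: smooth_scale => //; exact: smooth_cst.
by apply/funext => x; rewrite !fctE scaleN1r.
Qed.

Lemma smooth_sum V W (A : set V) (I : Type) (r : seq I) (f : I -> V -> W) :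
  open A -> (forall i, smooth A (f i)) -> smooth A (fun x =>
    \sum_(i <- r) f i x).
Proof. by move=> oA H k; apply: Ck_sum => // i; exact: H. Qed.

Lemma smooth_pair U V W (A : set U) (f : U -> V) (g : U -> W) :
  open A -> smooth A f -> smooth A g -> smooth A (fun x => (f x, g x)).
Proof.
move=> oA sf sg k; have := sg k; have := sf k; clear sf sg.
elim: k f g => [|k IH] f g.
  move=> cf cg x Ax.
  have c1 : f y @[y --> x] --> f x := cf x Ax.
  have c2 : g y @[y --> x] --> g x := cg x Ax.
  exact: cvg_pair c1 c2.
move=> [df Hf] [dg Hg]; split=> [x Ax|v].
  exact: differentiable_pair (df x Ax) (dg x Ax).
apply: Ck_ext (IH _ _ (Hf v) (Hg v)) => // x Ax.
exact: (congr1 (@^~ v) (esym (diff_pair (df x Ax) (dg x Ax)))).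
Qed.

Definition mxentry m n (i : 'I_m) (j : 'I_n) (M : 'M[R]_(m, n)) : R := M i j.

Fact mxentry_linear m n i j : linear (@mxentry m n i j).
Proof. by move=> a u v; rewrite /mxentry !mxE. Qed.
HB.instance Definition _ m n i j := GRing.isLinear.Build R 'M[R]_(m, n) R _
  (@mxentry m n i j) (@mxentry_linear m n i j).

Lemma smooth_mx V m n (A : set V) (f : V -> 'M[R]_(m, n)) : open A ->
  (forall i j, smooth A (fun x => f x i j : R)) -> smooth A f.
Proof.
move=> oA H k.
rewrite (_ : f = fun x => \sum_i \sum_j f x i j *: delta_mx i j); last first.
  by rewrite funeqE => x; exact: matrix_sum_delta.
apply: Ck_sum => // i; apply: Ck_sum => // j; apply: Ck_scale => //.
  exact: H.
exact: Ck_cst.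
Qed.

Lemma smooth_coord V m n (A : set V) (f : V -> 'M[R]_(m, n)) i j : open A ->
  smooth A f -> smooth A (fun x => f x i j : R).
Proof.
move=> oA H k.
apply: (@Ck_linear_comp _ _ _ k A f (@mxentry m n i j)) => //.
exact: coord_continuous.
Qed.

Lemma diff_mxentry V m n (f : V -> 'M[R]_(m, n)) (x : V) i j :
  differentiable f x -> is_diff x (fun y => f y i j : R) (fun v =>
    'd f x v i j).
Proof.
move=> df.
have := is_diff_comp (differentiableP df)
  (@is_diff_linear _ _ _ (@mxentry m n i j) (f x) (@coord_continuous _ m n i
    j)).
by [].
Qed.

Lemma framed_rV n : framed 'rV[R]_n.
Proof.
exists n, (fun j => delta_mx 0 j),
  (fun j => @mxentry 1 n 0 j : {linear 'rV[R]_n -> R}).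
split=> [j|w]; first exact: coord_continuous.
exact: row_sum_delta.
Qed.

Lemma framed_R : framed R.
Proof.
exists 1, (fun=> 1), (fun=> idfun); split=> [_ x //|w].
by rewrite big_ord1 /= [RHS]mulr1.
Qed.

(** The flow in a chart is a map of a time and a point; the frame allows the chain rule to be used
    for compositions with it. Index 0 is the time direction. *)
Lemma framed_prod_rV n : framed (R * 'rV[R]_n)%type.
Proof.
pose e (j : 'I_(1 + n)) : R * 'rV[R]_n :=
  if fintype.split j is inr i then (0, delta_mx 0 i) else (1, 0).
pose l (j : 'I_(1 + n)) (p : R * 'rV[R]_n) : R :=
  if fintype.split j is inr i then p.2 0 i else p.1.
have ll j : linear (l j : R * 'rV[R]_n -> R).
  by move=> a u v; rewrite /l; case: fintype.split => // i; rewrite /= !mxE.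
pose lL j : {linear (R * 'rV[R]_n)%type -> R} :=
  HB.pack (l j) (GRing.isLinear.Build R (R * 'rV[R]_n)%type R _ (l j) (ll j)).
exists (1 + n)%N, e, lL; split=> [j|[s w]].
  move=> p /=; rewrite /l; case: fintype.split => [_|i].
    exact: cvg_fst.
  apply: (@continuous_comp _ _ _ (@snd R 'rV[R]_n) (fun M : 'rV[R]_n => M 0 i)).
    exact: cvg_snd.
  exact: coord_continuous.
rewrite big_split_ord /= big_ord1 {1}/l /e /lL /=.
rewrite (_ : fintype.split (lshift n (0 : 'I_1)) = inl 0);
  last exact: (unsplitK (inl 0)).
under eq_bigr => i _ do rewrite /l (_ : fintype.split _ =
  inr i) ?(unsplitK (inr i)) //.
have -> : \sum_(i < n) w 0 i *: (0 : R, delta_mx 0 i : 'rV[R]_n) = (0, w).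
  rewrite [in RHS](row_sum_delta w); elim/big_rec2: _ => // i p q _ ->.
  by congr pair; rewrite /= scaler0 addr0.
by congr pair; rewrite /= ?scaler0 ?add0r ?addr0 // [RHS]mulr1.
Qed.

End Smoothness.

(** * Symmetry of second derivatives *)

Section Schwarz.
Context {R : realType} {V : normedModType R}.

Lemma is_derive_line (f : V -> R) (p v : V) (s : R) :
  differentiable f (p + s *: v) ->
  is_derive s 1 (fun t => f (p + t *: v)) ('d f (p + s *: v) v).
Proof.
move=> df.
have dl : is_diff s (fun t => p + t *: v) (fun t => t *: v).
  have := is_diffD (is_diff_cst p s) (is_diff_scalel s v).
  by move/is_diff_eq; apply; rewrite funeqE => t; rewrite !fctE add0r.
have [dc dcE] := is_diff_comp dl (differentiableP df).
apply: DeriveDef; first exact: diff_derivable.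
by rewrite (deriveE _ dc) [X in X 1]dcE /= scale1r.
Qed.

(* The mean value theorem is applied in the direction v only.  The second
   difference being symmetric in v and w, it gives both mixed derivatives. *)
Lemma second_difference (A : set V) (f : V -> R) (x v : V) (w : V) (e : R) :
  open A -> A x -> (forall y, A y -> differentiable f y) ->
  differentiable (fun y => 'd f y v) x -> 0 < e ->
  \forall h \near 0^'+, `|f (x + h *: w + h *: v) - f (x + h *: v)
      - f (x + h *: w) + f x - h ^+ 2 * 'd (fun y => 'd f y v) x w| <=
        e * h ^+ 2.
Proof.
move=> oA Ax df; set F := fun y => _; move=> dF e0.
(* For [s] and [t] in [0, h] the vector [t *: w + s *: v] has norm at most [h * N]. Two expansions
   of [F] are used below, each with error [e' * (h * N)]; after multiplication by [h] they add up to
   [e * h ^+ 2]. *)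
pose N := `|v| + `|w| + 1; pose e' := e / (2 * N).
have N0 : 0 < N by rewrite ltr_wpDl.
have e'0 : 0 < e' by rewrite divr_gt0 // mulr_gt0.
have nF : \forall k \near (0 : V), `|F (k + x) - (F x + 'd F x k)| <= e' * `|k|.
  by have /eqaddoP/(_ e' e'0) := diff_locally dF.
have nA : \forall k \near (0 : V), A (k + x).
  have : \forall y \near x, A y by exact: open_nbhs_nbhs.
  by rewrite (near_shift 0) subr0.
have [d d0 H] : exists2 d, 0 < d & forall k, `|k| < d ->
    A (k + x) /\ `|F (k + x) - (F x + 'd F x k)| <= e' * `|k|.
  have /nbhs_ballP[d d0 H] : \forall k \near (0 : V), A (k + x) /\
    `|F (k + x) - (F x + 'd F x k)| <= e' * `|k| by exact: filterI.
  exists d => // k kd; apply: H.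
  by rewrite -ball_normE /= sub0r normrN.
near=> h; have h0 : 0 < h by [].
have hd : h * N < d by rewrite -ltr_pdivlMr //; near: h; apply: nbhs_right_lt;
  rewrite divr_gt0.
have small s t : 0 <= s <= h -> 0 <= t <= h -> `|t *: w + s *: v| <= h * N.
  move=> /andP[s0 sh] /andP[t0 th]; apply: le_trans (ler_normD _ _) _.
  rewrite !normrZ !ger0_norm // /N.
  have := ler_wpM2r (normr_ge0 w) th; have := ler_wpM2r (normr_ge0 v) sh.
  by move: h0; lra.
have Hs s t : 0 <= s <= h -> 0 <= t <= h ->
    A (x + t *: w + s *: v) /\
    `|F (x + t *: w + s *: v) - F x - 'd F x (t *: w + s *: v)| <= e' * (h * N).
  move=> hs ht; have := H (t *: w + s *: v).
  move=> /(_ (le_lt_trans (small _ _ hs ht) hd))[].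
  rewrite addrC addrA => AA H2; split => //.
  rewrite -addrA -opprD; apply: le_trans H2 _.
  by rewrite ler_wpM2l ?small // ltW.
(* The increment of [psi] from 0 to [h] is the second difference, and its derivative is a difference
   of two values of [F]. *)
pose psi (s : R) := f (x + h *: w + s *: v) - f (x + s *: v).
pose dpsi (s : R) := F (x + h *: w + s *: v) - F (x + s *: v).
have hh : 0 <= h <= h by rewrite lexx ltW.
have h00 : 0 <= (0 : R) <= h by rewrite lexx ltW.
have dpsiP s : 0 <= s <= h -> is_derive s 1 psi (dpsi s).
  move=> hs; apply: is_deriveB.
    exact/is_derive_line/df/(Hs _ _ hs hh).1.
  apply: is_derive_line; apply: df.
  by have := (Hs _ _ hs h00).1; rewrite scale0r addr0.
have [xi] : exists2 xi, xi \in `[0, h] & psi h - psi 0 = dpsi xi * (h - 0).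
  apply: MVT_segment; first exact: ltW.
    by move=> s; rewrite in_itv /= => /andP[s0 sh]; apply: dpsiP; rewrite !ltW.
  apply: derivable_within_continuous => s; rewrite in_itv /= => hs.
  exact: (@ex_derive _ _ _ _ _ _ _ (dpsiP s hs)).
rewrite in_itv /= => hxi; rewrite subr0 => E.
have -> : f (x + h *: w + h *: v) - f (x + h *: v) - f (x + h *: w) + f x
   = dpsi xi * h.
  rewrite -E /psi scale0r !addr0 opprB addrA; lra.
have [_ H1] := Hs _ _ hxi hh.
have [_ H2] := Hs _ _ hxi h00.
(* In the difference of the two expansions around [x], the terms [F x] and ['d F x (xi *: v)] cancel
   and [h * 'd F x w] remains, whatever [xi] is. *)
have -> : dpsi xi * h - h ^+ 2 * 'd F x w = h *
   ((F (x + h *: w + xi *: v) - F x - 'd F x (h *: w + xi *: v))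
   - (F (x + 0 *: w + xi *: v) - F x - 'd F x (0 *: w + xi *: v))).
  rewrite /dpsi scale0r addr0 add0r !linearD !linearZ /=. 
  rewrite /GRing.scale /=; ring.
rewrite normrM gtr0_norm //.
apply: le_trans (ler_wpM2l (ltW h0) (le_trans (ler_normB _ _) (lerD H1 H2))) _.
have e'E : e' * (2 * N) = e by rewrite /e' divfK // gt_eqF // mulr_gt0.
suff -> : h * (e' * (h * N) + e' * (h * N)) = e * h ^+ 2 by [].
by rewrite -e'E; clear; ring.
Unshelve. all: by end_near. Qed.

Lemma schwarz_real (A : set V) (f : V -> R) (x v w : V) :
  open A -> A x -> (forall y, A y -> differentiable f y) ->
  differentiable (fun y => 'd f y v) x -> differentiable (fun y =>
    'd f y w) x ->
  'd (fun y => 'd f y v) x w = 'd (fun y => 'd f y w) x v.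
Proof.
move=> oA Ax df dv dw; apply/eqP; rewrite -subr_eq0 -normr_le0.
apply/ler_addgt0Pr => e e0; rewrite add0r.
have e20 : 0 < e / 2 by rewrite divr_gt0.
have H1 := second_difference w oA Ax df dv e20.
have H2 := second_difference v oA Ax df dw e20.
near (0 : R)^'+ => h; have h0 : 0 < h by [].
have : `|f (x + h *: w + h *: v) - f (x + h *: v)
      - f (x + h *: w) + f x - h ^+ 2 * 'd (fun y => 'd f y v) x w| <=
        e / 2 * h ^+ 2.
  by near: h; exact: H1.
have : `|f (x + h *: v + h *: w) - f (x + h *: w)
      - f (x + h *: v) + f x - h ^+ 2 * 'd (fun y => 'd f y w) x v| <=
        e / 2 * h ^+ 2.
  by near: h; exact: H2.
rewrite (addrAC x) => E2 E1.
have := le_trans (ler_normB _ _) (lerD E2 E1).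
set a := 'd _ x v; set b := 'd _ x w.
rewrite -mulrDl -splitr (_ : _ - _ = (b - a) * h ^+ 2); last ring.
by rewrite normrM (gtr0_norm (exprn_gt0 2 h0)) ler_pM2r ?exprn_gt0.
Unshelve. all: by end_near. Qed.

Lemma schwarz n (A : set V) (f : V -> 'rV[R]_n) (x v w : V) :
  open A -> A x -> smooth A f ->
  'd (fun y => 'd f y v) x w = 'd (fun y => 'd f y w) x v.
Proof.
move=> oA Ax sf; apply/rowP => j.
have df y : A y -> differentiable f y by exact: smooth_differentiable.
have dd u : differentiable (fun y => 'd f y u) x.
  exact: smooth_differentiable (smooth_diff u sf) Ax.
have E u : \forall y \near x, 'd f y u 0 j = 'd (fun z => f z 0 j : R) y u.
  near=> y; have Ay : A y by near: y; exact: open_nbhs_nbhs.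
  by have [_ ->] := diff_mxentry 0 j (df y Ay).
have D u : differentiable (fun y => 'd f y u 0 j : R) x by have [] :=
  diff_mxentry 0 j (dd u).
have [_ /(congr1 (@^~ w)) <-] := diff_mxentry 0 j (dd v).
have [_ /(congr1 (@^~ v)) <-] := diff_mxentry 0 j (dd w).
rewrite -(near_eq_diff (E v) (D v)) -(near_eq_diff (E w) (D w)).
apply: (schwarz_real oA Ax).
- by move=> y Ay; have [] := diff_mxentry 0 j (df y Ay).
- exact: near_eq_differentiable (E v) (D v).
- exact: near_eq_differentiable (E w) (D w).
Unshelve. all: by end_near. Qed.

End Schwarz.

(** * One-sided derivatives of curves *)

Section HasDerivative.
Context {R : realType}.
Implicit Types (J : set R) (V W : normedModType R) (t : R).

Lemma near_within_dnbhs (J : set R) (t : R) (P : set R) :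
  (\forall s \near t, P s) -> \forall s \near within J t^', P s.
Proof. by move=> H; apply: cvg_within; exact: nbhs_dnbhs. Qed.

Lemma near_within_dnbhs_neq J t : \forall s \near within J t^', s != t.
Proof. by rewrite !near_withinE; apply: nearW. Qed.

Lemma cvg_within_shift (J : set R) (r t : R) :
  (s + r) @[s --> within [set s | J (s + r)] (nbhs t)] -->
    within J (nbhs (t + r)).
Proof.
move=> P /= H; rewrite /within /=.
have ct : (s + r) @[s --> t] --> t + r by apply: cvgD;
  [exact: cvg_id|exact: cvg_cst].
exact: (ct _ H).
Qed.

Lemma cvg_within_dnbhs_shift (J : set R) (r t : R) :
  (s + r) @[s --> within [set s | J (s + r)] t^'] --> within J (t + r)^'.
Proof.
move=> P H.
have ct : (s + r) @[s --> t] --> t + r by apply: cvgD;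
  [exact: cvg_id|exact: cvg_cst].
have {}H : \forall s \near t + r, s != t + r -> J s -> P s := H.
suff : \forall s \near t, s != t -> J (s + r) -> P (s + r) by [].
have H2 : \forall s \near t, s + r != t + r -> J (s + r) -> P (s + r) := ct _ H.
apply: filterS H2 => s Hs st Js.
have st' : s + r != t + r by rewrite (inj_eq (addIr r)).
exact: (Hs st' Js).
Qed.

Lemma has_derivative_ext W J (g h : R -> W) t v :
  (\forall s \near t, J s -> g s = h s) -> g t = h t ->
  has_derivative J g t v -> has_derivative J h t v.
Proof.
move=> gh ght; apply: cvg_trans; apply: near_eq_cvg.
rewrite /within /=; apply: nbhs_dnbhs; apply: filterS gh => s gh /gh ->.
by rewrite ght.
Qed.

Lemma has_derivative_sub W J J' (g : R -> W) t v :
  J' `<=` J -> has_derivative J g t v -> has_derivative J' g t v.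
Proof. by move=> JJ; apply: cvg_trans; apply: cvg_app; exact: within_subset.
  Qed.

Lemma has_derivative_shift (W : normedModType R) (J : set R) (g : R ->
  W) (r t : R) v :
  has_derivative J g (t + r) v ->
  has_derivative [set s | J (s + r)] (fun s => g (s + r)) t v.
Proof.
move=> dg.
have : (s + r - (t + r))^-1 *: (g (s + r) - g (t + r))
    @[s --> within [set s | J (s + r)] t^'] --> v.
  have dg' : (s - (t + r))^-1 *: (g s - g (t + r)) @[s -->
    within J (t + r)^'] -->
    v := dg.
  exact: cvg_comp (@cvg_within_dnbhs_shift J r t) dg'.
apply: cvg_trans; apply: near_eq_cvg; near=> s.
by rewrite /= opprD addrACA subrr addr0.
Unshelve. all: by end_near. Qed.

Lemma has_derivative_cst (W : normedModType R) (J : set R) (w : W) (t : R) :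
  has_derivative J (cst w) t 0.
Proof. by apply: cvg_near_cst; near=> s; rewrite subrr scaler0. Unshelve.
  all: by end_near. Qed.

Lemma has_derivative_cvg_dnbhs W J (g : R -> W) t v :
  has_derivative J g t v -> g s @[s --> within J t^'] --> g t.
Proof.
move=> hg.
have st : (s - t) @[s --> within J t^'] --> (0 : R).
  rewrite -(subrr t); apply: cvgB; last exact: cvg_cst.
  by move=> A At; apply: cvg_within; exact: nbhs_dnbhs.
have : (s - t) *: ((s - t)^-1 *: (g s - g t)) + g t @[s --> within J t^'] -->
    (0 : R) *: v + g t by apply: cvgD; [exact: cvgZ|exact: cvg_cst].
rewrite scale0r add0r.
apply: cvg_trans; apply: near_eq_cvg; near=> s.
have s_t : s - t != 0 by rewrite subr_eq0; near: s;
  exact: near_within_dnbhs_neq.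
by rewrite scalerA divff // scale1r subrK.
Unshelve. all: by end_near. Qed.

Lemma has_derivative_continuous W J (g : R -> W) t v :
  has_derivative J g t v -> g s @[s --> within J (nbhs t)] --> g t.
Proof.
move=> /has_derivative_cvg_dnbhs /cvgrPdist_le H; apply/cvgrPdist_le => e e0.
have := H e e0; rewrite !near_withinE => He.
apply: filterS He => s Hs Js; have [->|st] := eqVneq s t; last exact: Hs.
by rewrite subrr normr0 ltW.
Qed.

Lemma has_derivative_comp V W J (f df : V -> W) (g : R -> V) t v :
  is_diff (g t) f df -> has_derivative J g t v ->
  has_derivative J (f \o g) t (df v).
Proof.
move=> [dfg <-] hg; set L := 'd f (g t).
have cL : continuous L by exact: diff_continuous.
(* The remainder of the expansion of [f] divided by [s - t]. It is at most [e'] times the difference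
   quotient of [g], whose norm is eventually below [|v| + 1]; hence the choice of [e'] below. *)
pose r s := (s - t)^-1 *: (f (g s) - f (g t) - L (g s - g t)).
have r0 : r s @[s --> within J t^'] --> (0 : W).
  apply/cvgr0Pnorm_le => e e0.
  pose e' := e / (`|v| + 1).
  have v0 : 0 < `|v| + 1 by rewrite ltr_wpDl.
  have e'0 : 0 < e' by rewrite divr_gt0.
  have F1 : \forall k \near (0 : V), `|f (k + g t) - (f (g t) + L k)| <=
    e' * `|k|.
    by have /eqaddoP/(_ e' e'0) := diff_locally dfg.
  have g0 : g s - g t @[s --> within J t^'] --> (0 : V).
    rewrite -(subrr (g t)); apply: cvgB; last exact: cvg_cst.
    exact: has_derivative_cvg_dnbhs hg.
  near=> s.
  have F2 : `|f (g s - g t + g t) - (f (g t) + L (g s - g t))| <=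
    e' * `|g s - g t|.
    by near: s; exact: (g0 _ F1).
  rewrite /r normrZ -addrA -opprD -[X in f X](subrK (g t)).
  apply: le_trans (ler_wpM2l (normr_ge0 _) F2) _.
  rewrite mulrCA -normrZ.
  have F3 : `|(s - t)^-1 *: (g s - g t)| <= `|v| + 1.
    near: s; apply: (cvgr_norm_le _ hg); by rewrite ltrDl.
  apply: le_trans (ler_wpM2l (ltW e'0) F3) _.
  by rewrite /e' divfK // gt_eqF.
have : L ((s - t)^-1 *: (g s - g t)) + r s @[s --> within J t^'] --> L v + 0.
  by apply: cvgD r0; apply: continuous_cvg hg; exact: cL.
rewrite addr0.
apply: cvg_trans; apply: near_eq_cvg; near=> s.
by rewrite /r [L (_ *: _)]linearZ /= -scalerDr subrKC.
Unshelve. all: by end_near. Qed.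

Lemma is_diff_has_derivative W J (g dg : R -> W) t :
  is_diff t g dg -> has_derivative J g t (dg 1).
Proof.
move=> dgt; have id1 : has_derivative J (@id R) t (1 : R).
  apply: cvg_near_cst; near=> s.
  rewrite [LHS]mulVf // subr_eq0; near: s; exact: near_within_dnbhs_neq.
by have := has_derivative_comp dgt id1.
Unshelve. all: by end_near. Qed.

Lemma has_derivativeD W J (f g : R -> W) t u v :
  has_derivative J f t u -> has_derivative J g t v ->
  has_derivative J (f + g) t (u + v).
Proof.
move=> hf hg; have : (s - t)^-1 *: (f s - f t) + (s - t)^-1 *: (g s - g t) @[s
  --> within J t^'] --> u + v.
  exact: cvgD.
apply: cvg_trans.
apply: near_eq_cvg; near=> s.
by rewrite !fctE -scalerDr opprD addrACA.
Unshelve. all: by end_near. Qed.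

Lemma has_derivativeM J (f g : R -> R) t u v :
  has_derivative J f t u -> has_derivative J g t v ->
  has_derivative J (f * g) t (f t * v + u * g t).
Proof.
move=> hf hg.
have : f s * ((s - t)^-1 *: (g s - g t)) + (s - t)^-1 *: (f s - f t) * g t
    @[s --> within J t^'] --> f t * v + u * g t.
  apply: cvgD; first exact: cvgM (has_derivative_cvg_dnbhs hf) hg.
  by apply: cvgM hf _; exact: cvg_cst.
apply: cvg_trans; apply: near_eq_cvg; near=> s.
by rewrite !fctE /GRing.scale /=; ring.
Unshelve. all: by end_near. Qed.

Lemma has_derivative_sum W J (I : Type) (r : seq I) (f : I -> R -> W) t df :
  (forall i, has_derivative J (f i) t (df i)) ->
  has_derivative J (fun s => \sum_(i <- r) f i s) t (\sum_(i <- r) df i).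
Proof.
move=> H; elim: r => [|i r IH].
  rewrite big_nil; under [X in has_derivative _ X]eq_fun do rewrite big_nil.
  apply: cvg_near_cst; near=> s.
  by rewrite subrr scaler0.
rewrite big_cons; under [X in has_derivative _ X]eq_fun do rewrite big_cons.
exact: has_derivativeD.
Unshelve. all: by end_near. Qed.

(** That [h] has a derivative is part of the conclusion: near [t] the function [F] does not vanish,
    and [h] is the product of [F * h] and the inverse of [F]. This is how a bump function is divided
    out of the multiplier equation. *)
Lemma has_derivative_factor (J : set R) (F h : R -> R) (t dF d : R) : J t ->
  has_derivative J F t dF -> F t != 0 -> has_derivative J (F * h) t d ->
  has_derivative J h t ((d - dF * h t) / F t).
Proof.
move=> Jt hF F0 hFh.
have dV : is_diff (F t) (fun y : R => y^-1) (fun u => - F t ^- 2 *: u).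
  by apply: DiffDef; [exact: differentiable_Rinv|rewrite diff_Rinv].
have := has_derivativeM hFh (has_derivative_comp dV hF).
rewrite (_ : _ + _ = (d - dF * h t) / F t); last first.
  by rewrite !fctE /= /GRing.scale /=; field.
apply: has_derivative_ext; last by rewrite !fctE /= mulrAC divff // mul1r.
have cF : F s @[s --> within J (nbhs t)] -->
  F t by exact: has_derivative_continuous hF.
have : \forall s \near within J (nbhs t),
  F s != 0 by exact: (cvgr_neq0 _ cF F0).
rewrite near_withinE; apply: filterS => s Fs Js.
by rewrite !fctE /= mulrAC divff ?mul1r // Fs.
Qed.

Lemma has_derivative_mxentry m n J (g : R -> 'M[R]_(m, n)) t v i j :
  has_derivative J g t v -> has_derivative J (fun s => g s i j : R) t (v i j).
Proof.
move=> hg.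
by have := has_derivative_comp (@is_diff_linear _ _ _ (@mxentry R m n i j) (g t)
  (@coord_continuous _ m n i j)) hg.
Qed.

Lemma has_derivative_mulmx m k n (J : set R) (B : R -> 'M[R]_(m,
  k)) (C : 'M[R]_(k, n))
    (t : R) dB i j : has_derivative J B t dB ->
  has_derivative J (fun s => (B s *m C) i j : R) t ((dB *m C) i j).
Proof.
move=> hB; under [X in has_derivative _ X]eq_fun do rewrite mxE.
rewrite mxE; apply: has_derivative_sum => l.
have := has_derivativeM (has_derivative_mxentry (i := i) (j :=
  l) hB) (has_derivative_cst J (C l j) t).
by rewrite mulr0 add0r.
Qed.

(** The covector is differentiated entry by entry because each test field of the multiplier equation
    yields one entry. *)
Lemma has_derivative_pairing_coord n (J : set R) (f : R -> 'cV[R]_n)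
    (g : R -> 'rV[R]_n) t (u : 'cV[R]_n) v :
  (forall j, has_derivative J (fun s => f s j 0 : R) t (u j 0)) ->
  has_derivative J g t v ->
  has_derivative J (fun s => pairing (f s) (g s)) t
    (pairing u (g t) + pairing (f t) v).
Proof.
move=> hf hg; rewrite /pairing !mxE -big_split /=.
under [X in has_derivative _ X]eq_fun do rewrite !mxE.
apply: has_derivative_sum => j; rewrite addrC.
rewrite addrC; apply: has_derivativeM; first exact: has_derivative_mxentry.
exact: hf.
Qed.

Lemma has_derivative_pairing n J (f : R -> 'cV[R]_n) (g : R -> 'rV[R]_n) t u v :
  has_derivative J f t u -> has_derivative J g t v ->
  has_derivative J (fun s => pairing (f s) (g s)) t
    (pairing u (g t) + pairing (f t) v).
Proof.
move=> hf; apply: has_derivative_pairing_coord => j.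
exact: has_derivative_mxentry.
Qed.

(** Uniqueness of one-sided derivatives rests on this. Since [a < b], points of the interval
    accumulate at [t] from the right when [t < b], and from the left when [t] is [b]. *)
Lemma within_itv_dnbhs_proper a b t : a < b -> t \in `[a, b] ->
  ProperFilter (within `[a, b] t^').
Proof.
move=> ab; rewrite in_itv /= => /andP[at_ tb].
suff H : within `[a, b] t^' set0 -> False by apply: Build_ProperFilter.
move=> H; have {}H : \forall s \near t, s != t -> ~ (a <= s <= b).
  suff : \forall s \near t, s != t -> s \in `[a, b] -> False.
    by apply: filterS => s Hs st sab; apply: (Hs st); rewrite in_itv.
  exact: H.
have [tb'|bt] := ltP t b.
  near t^'+ => s; have ts : t < s by [].
  apply: (_ : ~ (a <= s <= b)); last first.
    rewrite (le_trans at_ (ltW ts)) /= ltW //; near: s; exact: nbhs_right_lt.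
  have : s != t -> ~ (a <= s <= b) by near: s;
    exact: (@cvg_within _ (nbhs t) _ _ _ H).
  by apply; rewrite gt_eqF.
have at' : a < t by exact: lt_le_trans bt.
near t^'- => s; have ts : s < t by [].
apply: (_ : ~ (a <= s <= b)); last first.
  rewrite (le_trans (ltW ts) tb) andbT ltW //; near: s; exact: nbhs_left_gt.
have : s != t -> ~ (a <= s <= b) by near: s;
  exact: (@cvg_within _ (nbhs t) _ _ _ H).
by apply; rewrite lt_eqF.
Unshelve. all: by end_near. Qed.

Lemma has_derivative_unique W a b (g : R -> W) t u v : a < b -> t \in `[a, b] ->
  has_derivative `[a, b] g t u -> has_derivative `[a, b] g t v -> u = v.
Proof.
move=> ab tab; have ? := within_itv_dnbhs_proper ab tab.
exact: cvg_unique.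
Qed.

Lemma has_derivative_interior a b (g : R -> R) t v : t \in `]a, b[ ->
  has_derivative `[a, b] g t v -> is_derive t 1 g v.
Proof.
rewrite in_itv /= => /andP[at_ tb] hg.
suff H : h^-1 *: ((g \o shift t) (h *: (1 : R)) - g t) @[h --> 0^'] --> v.
  by apply: DeriveDef; [apply/cvg_ex; exists v|apply/cvg_lim].
apply/cvgrPdist_le => e e0.
have : \forall s \near t, s != t -> s \in `[a, b] ->
    `|v - (s - t)^-1 *: (g s - g t)| <= e.
  by have /cvgrPdist_le/(_ e e0) := hg.
have : \forall s \near t, s \in `[a, b].
  have := @near_in_itvoo R a b t; rewrite in_itv /= at_ tb => /(_ isT).
  by apply: filterS => s; exact: subset_itv_oo_cc.
rewrite !(near_shift 0 t) subr0 => I H.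
suff : \forall h \near (0 : R), h != 0 ->
  `|v - h^-1 *: (g (h *: (1 : R) + t) - g t)| <= e by [].
apply: filterS2 I H => h /= hab H h0.
by have := H _ hab; rewrite addrK [h *: 1]mulr1; apply; rewrite -subr_eq0 addrK.
Qed.

(** Between [s] and [t] the derivative within the interval is an ordinary one, as the mean value
    theorem requires; at [s] and [t] themselves only continuity is asked for. *)
Lemma has_derivative0_cst a b (g : R -> R) :
  (forall t, t \in `[a, b] -> has_derivative `[a, b] g t 0) ->
  forall s t, s \in `[a, b] -> t \in `[a, b] -> g s = g t.
Proof.
move=> H s t; wlog st : s t / s <= t.
  by move=> W sab tab; case: (leP s t) => [/W|/ltW/W] ->.
rewrite !in_itv /= => /andP[sa sb] /andP[ta tb].
have [||c _] := @MVT_segment R g (fun=> 0) s t st.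
- move=> x; rewrite in_itv /= => /andP[sx xt].
  apply: has_derivative_interior (H x _).
    by rewrite in_itv /= (le_lt_trans sa sx) (lt_le_trans xt tb).
  by rewrite in_itv /= !ltW ?(le_lt_trans sa sx) ?(lt_le_trans xt tb).
- apply/subspace_continuousP => x; rewrite /= in_itv /= => /andP[sx xt].
  have xab : x \in `[a, b] by rewrite in_itv /= (le_trans sa sx) (le_trans xt
    tb).
  have := has_derivative_continuous (H x xab).
  apply: cvg_trans; apply: cvg_app; apply: within_subset => y /=.
  by rewrite !in_itv /= => /andP[sy yt];
    rewrite (le_trans sa sy) (le_trans yt tb).
- by rewrite mul0r => /eqP; rewrite subr_eq0 => /eqP.
Qed.

End HasDerivative.

(** * Bump functions *)

Section Bump.
Context {R : realType}.

(** Since exp(y) = exp(y/m)^m and exp(y/m) >= 1 + y/m. *)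
Lemma expR_ge_exprn (m : nat) (y : R) : (0 < m)%N -> 0 <= y ->
  (y / m%:R) ^+ m <= expR y.
Proof.
move=> m0 y0; have -> : expR y = expR (y / m%:R) ^+ m.
  rewrite -expRM_natl; congr expR.
  by rewrite mulrCA divff ?mulr1 // pnatr_eq0 -lt0n.
have ym : 0 <= y / m%:R by rewrite divr_ge0.
rewrite lerXn2r ?nnegrE ?expR_ge0 //.
by apply: le_trans (expR_ge1Dx _); rewrite lerDr.
Qed.

(* P(1/x) exp(-1/x), extended by 0: the polynomial P makes this class of
   functions stable under differentiation. *)
Definition flat (P : {poly R}) (x : R) : R :=
  if 0 < x then P.[x^-1] * expR (- x^-1) else 0.

Lemma flat_bound (P : {poly R}) :
  exists C, forall x, 0 < x <= 1 -> `|flat P x| <= C * x.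
Proof.
(* For 1/x >= 1 the polynomial is at most C (1/x)^(size P), and exp(-1/x) is at most m^m x^m. Taking
   [m] one more than [size P] leaves one factor x. *)
pose m := (size P).+1; pose C := \sum_(i < size P) `|P`_i|.
exists (C * m%:R ^+ m) => x /andP[x0 x1]; rewrite /flat x0.
have y1 : 1 <= x^-1 by rewrite invf_ge1.
have y0 : 0 < x^-1 by rewrite invr_gt0.
have PC : `|P.[x^-1]| <= C * x^-1 ^+ size P.
  rewrite horner_coef /C mulr_suml; apply: le_trans (ler_norm_sum _ _ _) _.
  apply: ler_sum => i _; rewrite normrM ler_wpM2l // normrX gtr0_norm //.
  by rewrite ler_weXn2l // ltnW.
have EC : expR (- x^-1) <= m%:R ^+ m * x ^+ m.
  rewrite expRN -[leRHS]invrK lef_pV2 ?posrE ?expR_gt0 ?invr_gt0 ?mulr_gt0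
    ?exprn_gt0 //.
  rewrite -exprMn -exprVn invfM mulrC; apply: expR_ge_exprn => //; exact: ltW.
rewrite normrM (ger0_norm (expR_ge0 _)).
apply: le_trans (ler_pM (normr_ge0 _) (expR_ge0 _) PC EC) _.
have E1 : x^-1 ^+ size P * x ^+ size P =
  1 by rewrite -exprMn mulVf ?expr1n // gt_eqF.
move: E1; rewrite [x ^+ m]exprS.
move: (x^-1 ^+ size P) (x ^+ size P) (m%:R ^+ m) => A B D E1.
rewrite -[leRHS]mulr1 -E1.
by rewrite (_ : C * A * (D * (x * B)) = C * D * x * (A * B)) //; ring.
Qed.

(** For x > 0, differentiating P(1/x) exp(-1/x) gives x^(-2) (P - P')(1/x) exp(-1/x), whence the
    polynomial X^2 (P - P'). At 0 the difference quotient is [flat ('X * P) h] for h > 0, which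
    tends to 0 by [flat_bound]. *)
Lemma is_diff_flat (P : {poly R}) (x : R) :
  is_diff x (flat P) (fun h => h * flat ('X^2 * (P - P^`())) x).
Proof.
have [x0|x0|x0] := ltgtP x 0.
- have f0 : \forall y \near x, cst 0 y = flat P y.
    near=> y; rewrite /flat ltNge ltW //; near: y; exact: lt_nbhsl.
  apply: is_diff_eq (near_eq_is_diff f0 (differentiable_cst _ _)) _.
  by rewrite diff_cst; apply/funext => h; rewrite /flat ltNge ltW //= mulr0.
- have fE : \forall y \near x, P.[y^-1] * expR (- y^-1) = flat P y.
    near=> y; rewrite /flat ifT //; near: y; exact: lt_nbhsr.
  have xn : x != 0 by rewrite gt_eqF.
  have dV : is_diff x (fun y : R => y^-1) (fun h => h * - x ^- 2).
    apply: DiffDef; first exact: differentiable_Rinv.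
    by rewrite diff_Rinv //; apply/funext => h; rewrite [LHS]mulrC.
  have dP : is_diff (x^-1) (horner P) (fun h => h * P^`().[x^-1]).
    have H : is_derive (x^-1) 1 (horner P) P^`().[x^-1].
      by apply: DeriveDef; [exact: derivable_horner|rewrite derivE derive1E].
    exact: is_diff_real.
  have dE : is_diff (- x^-1) expR (fun h => h * expR (- x^-1)).
    by apply: is_diff_real; exact: is_derive_expR.
  have D1 := is_diff_comp dV dP.
  have D2 := is_diff_comp (is_diffN dV) dE.
  have D := is_diffM D1 D2.
  apply: is_diff_eq (near_eq_is_diff fE (@ex_diff _ _ _ _ _ _ _ D)) _.
  rewrite (@diff_val _ _ _ _ _ _ _ D); apply/funext => h.
  rewrite !fctE /= /flat x0 hornerM hornerXn hornerD hornerN [in RHS]exprVn.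
  rewrite /GRing.scale /=; ring.
- subst x; apply: is_diff_real.
  have f0 y : y <= 0 -> flat P y = 0 by rewrite /flat => y0; rewrite ltNge y0.
  have -> : flat ('X^2 * (P - P^`())) 0 = 0 by rewrite /flat ltxx.
  suff H : h^-1 *: ((flat P \o shift 0) (h *: (1 : R)) - flat P 0) @[h -->
    0^'] --> (0 : R).
    by apply: DeriveDef; [apply/cvg_ex; exists 0|apply/cvg_lim].
  have [C CP] := flat_bound ('X * P).
  have C0 : 0 <= C.
    have := CP 1; rewrite ltr01 lexx => /(_ isT); rewrite mulr1;
      exact: le_trans.
  apply/cvgr0Pnorm_le => e e0; near=> h.
  rewrite /= addr0 [h *: 1]mulr1 (f0 0) // subr0.
  have [h0|h0] := leP h 0; first by rewrite f0 // scaler0 normr0 ltW.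
  rewrite (_ : _ *: _ = flat ('X * P) h); last first.
    by rewrite /flat h0 hornerM hornerX -[RHS]mulrA.
  apply: le_trans (CP h _) _; last first.
    have : `|h| <= e / (C + 1).
      by near: h; apply: dnbhs0_le; rewrite divr_gt0 // ltr_wpDl.
    rewrite gtr0_norm // ler_pdivlMr ?ltr_wpDl // mulrDr mulr1 mulrC.
    by apply: le_trans; rewrite lerDl ltW.
  rewrite h0 /= -[leLHS]gtr0_norm //; near: h; exact: dnbhs0_le.
Unshelve. all: by end_near. Qed.

Lemma smooth_flat (P : {poly R}) : smooth setT (flat P).
Proof.
move=> k; elim: k P => [|k IH] P.
  by move=> x _; apply: differentiable_continuous; case: (is_diff_flat P x).
split=> [x _|v]; first by case: (is_diff_flat P x).
rewrite (_ : (fun x => _) = fun x => v *: flat ('X^2 * (P - P^`())) x).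
  by apply: Ck_scale (IH _); [exact: openT|exact: Ck_cst].
by apply/funext => x; have [_ ->] := is_diff_flat P x.
Qed.

(** The classical exp(-1/(r^2 - |y - p|^2)), extended by 0. The norm is the Euclidean one, whose
    square is polynomial in the coordinates, and not the maximum norm of row vectors. *)
Definition bump n (p : 'rV[R]_n) (r : R) (y : 'rV[R]_n) : R :=
  flat 1 (r ^+ 2 - \sum_j (y 0 j - p 0 j) ^+ 2).

Lemma smooth_bump n (p : 'rV[R]_n) (r : R) : smooth setT (bump p r).
Proof.
have oT : open (@setT 'rV[R]_n) := openT.
have sc j : smooth setT (fun y : 'rV[R]_n => y 0 j - p 0 j : R).
  apply: smoothB => //; last exact: smooth_cst.
  exact: (@smooth_linear _ _ _ _ (@mxentry R 1 n 0 j) (@coord_continuous _ _ _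
    _ _)).
change (smooth setT (flat 1 \o (fun y : 'rV[R]_n =>
  r ^+ 2 - \sum_j (y 0 j - p 0 j) *: (y 0 j - p 0 j : R) : R))).
apply: (smooth_comp (B := setT)) => //; [exact: framed_R| |exact: smooth_flat].
apply: smoothB => //; first exact: smooth_cst.
by apply: smooth_sum => // j; exact: smooth_scale.
Qed.

Lemma bump_gt0 n (p : 'rV[R]_n) (r : R) : 0 < r -> 0 < bump p r p.
Proof.
move=> r0; rewrite /bump /flat big1 => [|j _]; last by rewrite subrr expr0n.
by rewrite subr0 exprn_gt0 // hornerC mul1r expR_gt0.
Qed.

(** The maximum norm is attained at some coordinate, and the square of this coordinate alone already
    brings the sum to at least [r ^+ 2]. *)
Lemma bump_eq0 n (p : 'rV[R]_n) (r : R) y : 0 < r ->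
  r <= `|y - p| -> bump p r y = 0.
Proof.
move=> r0 ry; rewrite /bump /flat ifF //; apply/negbTE; rewrite -leNgt subr_le0.
have : exists i, `|y - p| = `|(y - p) 0 i|.
  have : `|y - p| != 0 by rewrite gt_eqF // (lt_le_trans r0).
  by move=> /mx_norm_neq0[[i j]/=]; rewrite (ord1 i) => E; exists j.
move=> [j yj]; rewrite (bigD1 j) //= ler_wpDr ?sumr_ge0 // => [i _|].
  exact: sqr_ge0.
by move: ry; rewrite yj !mxE -(real_normK (num_real (y 0 j - _))) => ry;
  rewrite lerXn2r ?nnegrE // ltW.
Qed.

End Bump.

(** * Calculus in the charts of a manifold *)

Section Pairing.
Context {R : realType} {n : nat}.
Implicit Types (eta zeta : 'cV[R]_n) (u v : 'rV[R]_n).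

Lemma pairingE (eta : 'cV[R]_n) (v : 'rV[R]_n) : pairing eta v =
  \sum_j v 0 j * eta j 0.
Proof. by rewrite /pairing mxE. Qed.

Lemma pairingB (eta : 'cV[R]_n) u v : pairing eta (u - v) =
  pairing eta u - pairing eta v.
Proof. by rewrite /pairing mulmxBl !mxE. Qed.

Lemma pairingZ (eta : 'cV[R]_n) r v : pairing eta (r *: v) = r * pairing eta v.
Proof. by rewrite /pairing -scalemxAl mxE. Qed.

Lemma pairing_delta (eta : 'cV[R]_n) j : pairing eta (delta_mx 0 j) = eta j 0.
Proof. by rewrite /pairing -rowE mxE. Qed.

Lemma pairing_inj (eta zeta : 'cV[R]_n) :
  (forall v, pairing eta v = pairing zeta v) -> eta = zeta.
Proof.
move=> H; apply/colP => j; have := H (delta_mx 0 j).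
by rewrite /pairing -!rowE !mxE.
Qed.

(** Both [chart_cocoord] and [cotangent_map] list the values of a covector on images of basis
    vectors; this makes each of them a transpose. *)
Lemma pairing_col_linear (eta : 'cV[R]_n) (f : {linear 'rV[R]_n ->
  'rV[R]_n}) v :
  pairing (\col_j pairing eta (f (delta_mx 0 j))) v = pairing eta (f v).
Proof.
rewrite {2}(row_sum_delta v) linear_sum /pairing mulmx_suml summxE mxE.
by apply: eq_bigr => j _; rewrite mxE /pairing linearZ /= -scalemxAl !mxE.
Qed.

End Pairing.

Section Charts.
Context {R : realType} {n : nat} {M : manifold R n}.
Implicit Types (x : M) (i j : chart_index M).

Lemma chart_atP x : cdom (chart_at x) x.
Proof. by rewrite /chart_at; case: cid. Qed.

Lemma mem_chart_img i (U : set M) y :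
  (cmap i @` (cdom i `&` U)) y <-> (cmap i @` cdom i) y /\ U (cinv i y).
Proof.
split=> [[x [ix Ux] <-]|[[x ix <-]]]; first by rewrite cmapK //; split => //;
  exists x.
by rewrite cmapK // => Ux; exists x.
Qed.

Lemma cinvK i y : (cmap i @` cdom i) y -> cmap i (cinv i y) = y.
Proof. by move=> [x ix <-]; rewrite cmapK. Qed.

Lemma cdom_cinv i y : (cmap i @` cdom i) y -> cdom i (cinv i y).
Proof. by move=> [x ix <-]; rewrite cmapK. Qed.

Lemma chart_img_open i (U : set M) : open U -> open (cmap i @` (cdom i `&` U)).
Proof.
move=> oU; rewrite openE => y /mem_chart_img[iy Uy].
have ni : \forall z \near y, (cmap i @` cdom i) z.
  by apply: open_nbhs_nbhs; split => //; exact: cimg_open.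
have nU : \forall z \near y, U (cinv i z).
  by apply: (cinv_continuous iy); exact: open_nbhs_nbhs.
by apply: filterS2 ni nU => z iz Uz; apply/mem_chart_img.
Qed.

Lemma near_cdom i x : cdom i x -> \forall y \near x, cdom i y.
Proof. by move=> ix; apply: open_nbhs_nbhs; split => //; exact: cdom_open. Qed.

Lemma near_cinv i x (U : set M) : cdom i x -> open U -> U x ->
  \forall y \near cmap i x, (cmap i @` (cdom i `&` U)) y.
Proof.
move=> ix oU Ux; apply: open_nbhs_nbhs; split; first exact: chart_img_open.
by exists x.
Qed.

Lemma cinv_cvg i x : cdom i x -> cinv i y @[y --> cmap i x] --> x.
Proof.
move=> ix; have : cinv i y @[y --> cmap i x] --> cinv i (cmap i x).
  by apply: cinv_continuous; exists x.
by rewrite cmapK.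
Qed.

(** The coordinate change between two arbitrary charts; [chart_coord j x] is the case where [i] is
    the chart chosen at [x]. *)
Definition dtransition i j x (v : 'rV[R]_n) : 'rV[R]_n :=
  'd (cmap j \o cinv i) (cmap i x) v.

Lemma differentiable_transition i j x : cdom i x -> cdom j x ->
  differentiable (cmap j \o cinv i) (cmap i x).
Proof.
move=> ix jx; apply: smooth_differentiable (@chart_compat _ _ M i j) _.
by exists x.
Qed.

Lemma is_diff_chart_codom (V : normedModType R) (F : V -> M) (p : V) i j
    (dF : V -> 'rV[R]_n) :
  {for p, continuous F} -> cdom i (F p) -> cdom j (F p) ->
  is_diff p (cmap i \o F) dF ->
    is_diff p (cmap j \o F) (dtransition i j (F p) \o dF).
Proof.
move=> cF ip jp dFp.
have D := is_diff_comp dFp (differentiableP (differentiable_transition ip jp)).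
have E : \forall q \near p, ((cmap j \o cinv i) \o (cmap i \o F)) q =
  (cmap j \o F) q.
  have : \forall q \near p, cdom i (F q) by exact: (cF _ (near_cdom ip)).
  by apply: filterS => q iq /=; rewrite cmapK.
apply: is_diff_eq (near_eq_is_diff E (@ex_diff _ _ _ _ _ _ _ D)) _.
by rewrite (@diff_val _ _ _ _ _ _ _ D).
Qed.

Lemma is_diff_chart_dom (W : normedModType R) (G : M -> W) x i j
    (dG : 'rV[R]_n -> W) :
  cdom i x -> cdom j x ->
  is_diff (cmap i x) (G \o cinv i) dG ->
  is_diff (cmap j x) (G \o cinv j) (dG \o dtransition j i x).
Proof.
move=> ix jx dGx.
have tx : (cmap i \o cinv j) (cmap j x) = cmap i x by rewrite /= cmapK.
rewrite -tx in dGx.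
have D := is_diff_comp (differentiableP (differentiable_transition jx ix)) dGx.
have E : \forall q \near cmap j x, ((G \o cinv i) \o (cmap i \o cinv j)) q =
  (G \o cinv j) q.
  have := near_cinv jx (@cdom_open _ _ M i) ix.
  by apply: filterS => q /mem_chart_img[_ iq] /=; rewrite cmapK.
apply: is_diff_eq (near_eq_is_diff E (@ex_diff _ _ _ _ _ _ _ D)) _.
by rewrite (@diff_val _ _ _ _ _ _ _ D).
Qed.

Lemma dtransition_comp i j k x v : cdom i x -> cdom j x -> cdom k x ->
  dtransition j k x (dtransition i j x v) = dtransition i k x v.
Proof.
move=> ix jx kx.
have D := is_diff_chart_dom jx ix (differentiableP (differentiable_transition
  jx kx)).
by have [_ /(congr1 (@^~ v))] := D.
Qed.

Lemma dtransition_id i x v : cdom i x -> dtransition i i x v = v.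
Proof.
move=> ix; rewrite /dtransition.
have E : \forall q \near cmap i x, id q = (cmap i \o cinv i) q.
  have := near_cinv ix openT I; apply: filterS => q /mem_chart_img[iq _] /=.
  by rewrite cinvK.
have [did dE] := is_diff_id (cmap i x).
have H : 'd (cmap i \o cinv i) (cmap i x) = id :> ('rV[R]_n -> 'rV[R]_n).
  by rewrite -dE; exact: near_eq_diff E did.
by rewrite H.
Qed.

Lemma dtransitionK i j x : cdom i x -> cdom j x ->
  cancel (dtransition i j x) (dtransition j i x).
Proof. by move=> ix jx v; rewrite dtransition_comp // dtransition_id. Qed.

Lemma pairing_cocoord i x (eta : 'cV[R]_n) v :
  pairing (chart_cocoord i x eta) v =
    pairing eta (dtransition i (chart_at x) x v).
Proof. exact: pairing_col_linear. Qed.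

Lemma pairing_chart i x eta v : cdom i x ->
  pairing (chart_cocoord i x eta) (chart_coord i x v) = pairing eta v.
Proof.
move=> ix; rewrite pairing_cocoord; congr pairing.
by apply: dtransitionK => //; exact: chart_atP.
Qed.

Lemma chart_coord_id x v : chart_coord (chart_at x) x v = v.
Proof. by apply: dtransition_id; exact: chart_atP. Qed.

Lemma chart_coordB i x u v :
  chart_coord i x (u - v) = chart_coord i x u - chart_coord i x v.
Proof. by rewrite /chart_coord linearB. Qed.

Lemma chart_cocoord_id x eta : chart_cocoord (chart_at x) x eta = eta.
Proof.
apply: pairing_inj => v; rewrite pairing_cocoord dtransition_id //;
  exact: chart_atP.
Qed.

Lemma local_repE i (X : M -> 'rV[R]_n) x : cdom i x ->
  local_rep i X (cmap i x) = chart_coord i x (X x).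
Proof. by move=> ix; rewrite /local_rep cmapK. Qed.

Lemma local_rep_at (X : M -> 'rV[R]_n) x :
  local_rep (chart_at x) X (cmap (chart_at x) x) = X x.
Proof. by rewrite local_repE ?chart_coord_id //; exact: chart_atP. Qed.

Lemma differentiable_local_rep i (U : set M) X x :
  smooth_vector_field U X -> cdom i x -> U x ->
  differentiable (local_rep i X) (cmap i x).
Proof. by move=> sX ix Ux; apply: smooth_differentiable (sX i) _; exists x. Qed.

(** The velocity is defined in the chart chosen at [c t]. The continuity included in [has_velocity]
    keeps [c s] in the domain of that chart, so that the transition map to [i] can be composed with
    it. *)
Lemma has_velocity_chart i (J : set R) (c : R -> M) t v : cdom i (c t) ->
  has_velocity J c t v ->
  has_derivative J (cmap i \o c) t (chart_coord i (c t) v).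
Proof.
move=> ic [cc dc].
have jc := chart_atP (c t).
have D : is_diff ((cmap (chart_at (c t)) \o c) t) (cmap i \o cinv (chart_at (c
  t)))
    (dtransition (chart_at (c t)) i (c t)).
  exact/differentiableP/differentiable_transition.
have := has_derivative_comp D dc; apply: has_derivative_ext;
  last by rewrite /= cmapK.
have : \forall s \near within J (nbhs t), cdom (chart_at (c t)) (c s).
  exact: (cc _ (near_cdom jc)).
by rewrite near_withinE; apply: filterS => s H /H js /=; rewrite cmapK.
Qed.

Lemma tangent_map_near_eq (f g : M -> M) (x : M) v :
  (\forall y \near x, f y = g y) ->
  differentiable (cmap (chart_at (f x)) \o f \o cinv (chart_at x)) (cmap
    (chart_at x) x) ->
  tangent_map f x v = tangent_map g x v.
Proof.
move=> fg df; have fgx := nbhs_singleton fg.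
have E : \forall q \near cmap (chart_at x) x,
    (cmap (chart_at (f x)) \o f \o cinv (chart_at x)) q =
    (cmap (chart_at (g x)) \o g \o cinv (chart_at x)) q.
  have H : \forall q \near cmap (chart_at x) x,
      f (cinv (chart_at x) q) = g (cinv (chart_at x) q) :=
        cinv_cvg (chart_atP x) fg.
  by apply: filterS H => q /= ->; rewrite fgx.
apply: (congr1 (fun h : 'rV[R]_n -> 'rV[R]_n => h v)).
exact/esym/(near_eq_diff E df).
Qed.

Lemma tangent_map_comp (f g : M -> M) x v :
  {for x, continuous f} -> {for f x, continuous g} ->
  differentiable (cmap (chart_at (f x)) \o f \o cinv (chart_at x)) (cmap
    (chart_at x) x) ->
  differentiable (cmap (chart_at (g (f x))) \o g \o cinv (chart_at (f x)))
    (cmap (chart_at (f x)) (f x)) ->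
  tangent_map (g \o f) x v = tangent_map g (f x) (tangent_map f x v).
Proof.
move=> cf cg; rewrite /tangent_map.
set F := _ \o cinv (chart_at x); set G := _ \o cinv (chart_at (f x)).
set q := cmap (chart_at (f x)) (f x) => dF dG.
have Fq : F (cmap (chart_at x) x) = q by rewrite /F /= cmapK //;
  exact: chart_atP.
rewrite -Fq in dG *.
have H : \forall y \near cmap (chart_at x) x,
  cdom (chart_at (f x)) (f (cinv (chart_at x) y)).
  have cff : f (cinv (chart_at x) y) @[y --> cmap (chart_at x) x] --> f x.
    exact: cvg_comp (cinv_cvg (chart_atP x)) cf.
  exact: (cff _ (near_cdom (chart_atP (f x)))).
have E : \forall y \near cmap (chart_at x) x, (G \o F) y =
    (cmap (chart_at ((g \o f) x)) \o (g \o f) \o cinv (chart_at x)) y.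
  by apply: filterS H => y Hy; rewrite /G /F /= cmapK.
have D : differentiable (G \o F) (cmap (chart_at x) x) by exact:
  differentiable_comp.
transitivity ('d (G \o F) (cmap (chart_at x) x) v).
  apply: (congr1 (fun h : 'rV[R]_n -> 'rV[R]_n => h v)).
  exact: (near_eq_diff E D).
have /(congr1 (@^~ v)) DE := diff_comp dF dG.
exact: DE.
Qed.

Lemma pairing_cotangent_map (f : M -> M) x (alpha : 'cV[R]_n) v :
  pairing (cotangent_map f x alpha) v = pairing alpha (tangent_map f x v).
Proof. exact: pairing_col_linear. Qed.

Lemma integral_curve_shift (U : set M) (X : M -> 'rV[R]_n) (J : set R) (c :
  R -> M) r :
  integral_curve U X J c ->
  integral_curve U X [set s | J (s + r)] (fun s => c (s + r)).
Proof.
move=> H t /= Jt; have [Ut [cc dc]] := H _ Jt; split => //; split.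
  exact: cvg_comp (@cvg_within_shift R J r t) cc.
exact: has_derivative_shift dc.
Qed.

End Charts.

(** * Brackets with sections of a distribution *)

Section Frame.
Context {R : realType}.

Lemma norm_rV_le k (w : 'rV[R]_k) (e : R) : 0 <= e ->
  (forall j, `|w 0 j| <= e) -> `|w| <= e.
Proof.
move=> e0 H; rewrite [leLHS]/Num.Def.normr /= mx_normrE.
by apply: bigmax_le => // -[i j] _; rewrite (ord1 i).
Qed.

Lemma entry_le_norm m k (w : 'M[R]_(m, k)) i j : `|w i j| <= `|w|.
Proof.
rewrite [leRHS]/Num.Def.normr /= mx_normrE; exact: (le_bigmax _ _ (i, j)).
Qed.

(** A matrix close to the identity shrinks no vector by more than one half: in w = w (1 - A) + w A
    the first term has norm at most |w|/2. The bound has [k.+1] in place of [k] so that it is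
    positive for [k = 0] as well. *)
Lemma norm_le_mulmx k (A : 'M[R]_k) (w : 'rV[R]_k) :
  (forall i j, `|(1%:M - A) i j| <= (2 * k.+1%:R)^-1) -> `|w| <= 2 * `|w *m A|.
Proof.
move=> HA; have k0 : (0 : R) < k.+1%:R by rewrite ltr0n.
suff : `|w| <= `|w| / 2 + `|w *m A| by lra.
apply: norm_rV_le => [|j]; first by rewrite addr_ge0 // divr_ge0.
have -> : w 0 j = (w *m (1%:M - A)) 0 j + (w *m A) 0 j.
  by rewrite mulmxBr mulmx1 !mxE subrK.
apply: le_trans (ler_normD _ _) _; apply: lerD; last exact: entry_le_norm.
rewrite mxE; apply: le_trans (ler_norm_sum _ _ _) _.
apply: (@le_trans _ _ (\sum_(i < k) `|w| * (2 * k.+1%:R)^-1)).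
  apply: ler_sum => i _; rewrite normrM; apply: ler_pM => //;
    exact: entry_le_norm.
rewrite sumr_const card_ord -[leLHS]mulr_natr -[leLHS]mulrA ler_wpM2l //.
rewrite invfM -[leLHS]mulrA -[leRHS]mulr1 ler_wpM2l // mulrC ler_pdivrMr //
  mul1r.
by rewrite ler_nat.
Qed.

(* Z eta = w (F eta) with w -> 0 and F eta = O(h) near p, hence Z eta = o(h):
   the coefficients w need not be differentiable. *)
Lemma pairing_diff_frame k n (Fm : 'rV[R]_n -> 'M[R]_(k, n))
    (Z : 'rV[R]_n -> 'rV[R]_n) (p u : 'rV[R]_n) (eta : 'cV[R]_n) :
  row_free (Fm p) -> differentiable Fm p -> differentiable Z p -> Z p = 0 ->
  (\forall y \near p, exists w : 'rV_k, Z y = w *m Fm y) ->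
  Fm p *m eta = 0 -> pairing eta ('d Z p u) = 0.
Proof.
move=> /row_freeP[G FG] dF dZ Zp HZ Fe.
pose l (h : R) : 'rV[R]_n := p + h *: u.
have l0 : l 0 = p by rewrite /l scale0r addr0.
have dl : is_diff (0 : R) l (fun h => h *: u).
  have := is_diffD (is_diff_cst p (0 : R)) (is_diff_scalel 0 u).
  by move/is_diff_eq; apply; rewrite funeqE => t; rewrite !fctE add0r.
rewrite -l0 in dF dZ.
have hl : has_derivative setT l 0 u.
  by have := is_diff_has_derivative setT dl; rewrite scale1r.
have hZ := has_derivative_comp (differentiableP dZ) hl.
have hF := has_derivative_comp (differentiableP dF) hl.
have cl : l h @[h --> (0 : R)] --> p.
  by rewrite -l0; apply: differentiable_continuous; case: dl.
have {}HZ : \forall h \near (0 : R), exists w : 'rV_k, Z (l h) = w *m Fm (l h).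
  exact: (cl _ HZ).
(* A choice of coefficients for each [h], without any regularity in [h]; the default 0 is met only
   away from [h = 0]. *)
pose w h := xget 0 [set w : 'rV_k | Z (l h) = w *m Fm (l h)].
have {}HZ : \forall h \near (0 : R), Z (l h) = w h *m Fm (l h).
  apply: filterS HZ => h [v Hv]; rewrite /w; case: xgetP => [v' -> //|H].
  by have := H v.
(* With [G] a right inverse of [Fm p], the matrix [Fm (l h) *m G] tends to the identity. By
   [norm_le_mulmx] the norm of [w h] is then at most twice that of [Z (l h) *m G], which tends to 0
   because [Z p = 0]. *)
have w0 j : w h 0 j @[h --> within setT (0 : R)^'] --> (0 : R).
  have N0 : (0 : R) < (2 * k.+1%:R)^-1 by rewrite invr_gt0 mulr_gt0.
  have nA : \forall h \near within setT (0 : R)^',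
      forall ij : 'I_k * 'I_k, `|(1%:M - Fm (l h) *m G) ij.1 ij.2| <=
        (2 * k.+1%:R)^-1.
    apply: filter_forall => -[i j'] /=.
    have /cvgrPdist_le/(_ _ N0) :=
      has_derivative_cvg_dnbhs (has_derivative_mulmx (C := G) (i := i) (j :=
        j') hF).
    by apply: filterS => h; rewrite /comp l0 FG !mxE.
  apply/cvgr0Pnorm_le => e e0.
  have e20 : 0 < e / 2 by rewrite divr_gt0.
  have nZ : \forall h \near within setT (0 : R)^', forall i,
    `|(Z (l h) *m G) 0 i| <= e / 2.
    apply: filter_forall => i.
    have /cvgrPdist_le/(_ _ e20) :=
      has_derivative_cvg_dnbhs (has_derivative_mulmx (C := G) (i := 0) (j :=
        i) hZ).
    by apply: filterS => h; rewrite /comp l0 Zp mul0mx [X in X - _]mxE sub0r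
      normrN.
  near=> h.
  have HA : forall ij : 'I_k * 'I_k,
      `|(1%:M - Fm (l h) *m G) ij.1 ij.2| <= (2 * k.+1%:R)^-1.
    by near: h; exact: nA.
  apply: le_trans (entry_le_norm _ _ _) _.
  have Hw := @norm_le_mulmx k (Fm (l h) *m G) (w h) (fun i j' => HA (i, j')).
  apply: (le_trans Hw).
  have -> : w h *m (Fm (l h) *m G) = Z (l h) *m G.
    by rewrite mulmxA; congr (_ *m _); apply/esym; near: h;
      exact: near_within_dnbhs.
  rewrite -ler_pdivlMl // mulrC.
  by apply: norm_rV_le; [exact: ltW|near: h; exact: nZ].
have hq j : (h - 0)^-1 *: ((Fm (l h) *m eta) j 0 - (Fm (l 0) *m eta) j 0)
    @[h --> within setT (0 : R)^'] --> ('d Fm (l 0) u *m eta) j 0.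
  exact: (has_derivative_mulmx (C := eta) (i := j) (j := 0) hF).
(* As [Fm p *m eta = 0], this sum is the difference quotient of [pairing eta (Z (l h))]. Each term
   is a coefficient tending to 0 times a convergent quotient. *)
have : \sum_j w h 0 j * ((h - 0)^-1 *: ((Fm (l h) *m eta) j 0 - (Fm (l 0) *m
  eta) j 0))
    @[h --> within setT (0 : R)^'] --> (0 : R).
  rewrite [X in _ --> X](_ : _ =
    \sum_(j < k) (0 * ('d Fm (l 0) u *m eta) j 0)); last first.
    by rewrite big1 // => j _; rewrite mul0r.
  by apply: cvg_big => [|j _]; [exact: add_continuous|apply: cvgM];
    [exact: w0|exact: hq].
move=> H.
have H0 : has_derivative setT (fun h => pairing eta (Z (l h))) 0 0.
  apply: cvg_trans H; apply: near_eq_cvg; near=> h.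
  have -> : Z (l h) = w h *m Fm (l h) by near: h; exact: near_within_dnbhs.
  have -> : pairing eta (Z (l 0)) = 0 by rewrite l0 Zp /pairing mul0mx mxE.
  have -> : pairing eta (w h *m Fm (l h)) =
    \sum_j w h 0 j * (Fm (l h) *m eta) j 0.
    by rewrite /pairing -mulmxA mxE.
  rewrite l0 Fe !subr0 scaler_sumr; apply: eq_bigr => j _.
  by rewrite [(0 : 'cV__) j 0]mxE subr0 scalerAr.
have := has_derivative_pairing (has_derivative_cst setT eta 0) hZ.
rewrite [pairing 0 _](_ : _ = 0) ?add0r => [H1|];
  last by rewrite /pairing mulmx0 mxE.
rewrite -l0.
apply: (@has_derivative_unique _ _ (-1) 1 _ 0 _ _ _ _
  (has_derivative_sub (@subsetT _ _) H1) (has_derivative_sub (@subsetT _ _)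
    H0)).
  by rewrite gtrN.
by rewrite in_itv /= lerN10 ler01.
Unshelve. all: by end_near. Qed.

End Frame.

Section Bracket.
Context {R : realType} {n : nat} {M : manifold R n}.
Implicit Types (x : M) (i : chart_index M).

(** The difference of the two sections is a section of [Q] that vanishes at [x], hence a combination
    of a local frame to which [pairing_diff_frame] applies. This is the reason why [bracket_pairing]
    does not depend on the section that extends the velocity. *)
Lemma pairing_diff_section k (Q : M -> {vspace 'rV[R]_n}) (U V : set M) x
    (X Y : M -> 'rV[R]_n) (eta : 'cV[R]_n) u :
  regular_distribution k Q ->
  open U -> U x -> section_of Q U X -> open V -> V x -> section_of Q V Y ->
  X x = Y x -> annihilates Q x eta ->
  pairing eta ('d (local_rep (chart_at x) X) (cmap (chart_at x) x) u) =
  pairing eta ('d (local_rep (chart_at x) Y) (cmap (chart_at x) x) u).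
Proof.
move=> Qreg oU Ux [sX XQ] oV Vx [sY YQ] XY eQ.
have [W [F [oW Wx sF FQ]]] := Qreg x.
set i := chart_at x; set p := cmap i x.
have ix : cdom i x := chart_atP x.
have dX := differentiable_local_rep sX ix Ux.
have dY := differentiable_local_rep sY ix Vx.
apply/eqP; rewrite -subr_eq0; apply/eqP.
have -> : pairing eta ('d (local_rep i X) p u) - pairing eta ('d (local_rep i
  Y) p u)
  = pairing eta ('d (local_rep i X - local_rep i Y) p u).
  have /(congr1 (@^~ u)) E := diffB dX dY.
  transitivity (pairing eta ('d (local_rep i X) p u - 'd (local_rep i Y) p u)).
    by rewrite pairingB.
  by congr pairing; exact/esym/E.
(* The rows are a local frame of [Q] read in the chart; [FE] and [memQ] translate membership in [Q]
   into the existence of coefficients for these rows. *)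
pose Fm y := \matrix_(j < k) local_rep i (F j) y.
have rowF j y : row j (Fm y) = local_rep i (F j) y by rewrite rowK.
have FE y : cdom i y -> forall w : 'rV_k, w *m Fm (cmap i y) =
    chart_coord i y (\sum_j w 0 j *: F j y).
  move=> iy w; rewrite mulmx_sum_row /chart_coord linear_sum;
    apply: eq_bigr => j _.
  by rewrite linearZ rowF local_repE.
have memQ y v : W y -> v \in Q y -> exists w : 'rV_k, v = \sum_j w 0 j *: F j y.
  move=> Wy; rewrite (FQ y Wy).2 span_def big_map big_enum /= =>
    /memv_sumP[vs vsF ->].
  have /choice[w wE] : forall j, exists a : R, vs j = a *: F j y.
    by move=> j; have /vlineP := vsF j isT.
  exists (\row_j w j); apply: eq_bigr => j _; by rewrite mxE.
apply: (@pairing_diff_frame _ k n Fm (local_rep i X - local_rep i Y)).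
- apply: inj_row_free => w; rewrite FE // chart_coord_id => H.
  have fr : free [tuple F j x | j < k].
    by rewrite /free -(FQ x Wx).2 (FQ x Wx).1 size_tuple.
  apply/rowP => j; rewrite mxE; move/freeP: fr => fr;
    apply: (fr (fun j => w 0 j)).
  by rewrite -[RHS]H; apply: eq_bigr => l _; rewrite -tnth_nth tnth_mktuple.
- have sFm : smooth (cmap i @` (cdom i `&` W)) Fm.
    have oA : open (cmap i @` (cdom i `&` W)) by exact: chart_img_open.
    apply: smooth_mx => // j l.
    apply: (smooth_ext (f := fun y => local_rep i (F j) y 0 l)) => //.
      by move=> y _; rewrite mxE.
    by apply: smooth_coord => //; exact: sF.
  by apply: smooth_differentiable sFm _; exists x.
- exact: differentiableB.
- by rewrite !fctE !local_repE // XY subrr.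
- have := near_cinv ix (openI (openI oU oV) oW) (conj (conj Ux Vx) Wx).
  apply: filterS => q /mem_chart_img[iq [[Uq Vq] Wq]].
  have := memQ (cinv i q) (X (cinv i q) - Y (cinv i q)) Wq.
  rewrite rpredB ?XQ ?YQ // => /(_ isT)[w wE]; exists w.
  have iq' := cdom_cinv iq.
  have := FE (cinv i q) iq' w; rewrite cinvK // => ->.
  by rewrite -wE chart_coordB.
- apply/colP => j; rewrite [RHS]mxE.
  have -> : (Fm p *m eta) j 0 = pairing eta (row j (Fm p)).
    by rewrite /pairing -row_mul [in RHS]mxE.
  rewrite rowF /p local_repE // chart_coord_id; apply: eQ.
  by rewrite (FQ x Wx).2; apply: memv_span; apply: (map_f (fun j => F j x));
    rewrite mem_enum.
Qed.

Lemma pairing_lie_bracket x (X Y : M -> 'rV[R]_n) (eta : 'cV[R]_n) :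
  pairing eta (lie_bracket X Y x) =
  pairing eta ('d (local_rep (chart_at x) Y) (cmap (chart_at x) x) (X x)) -
  pairing eta ('d (local_rep (chart_at x) X) (cmap (chart_at x) x)
    (local_rep (chart_at x) Y (cmap (chart_at x) x))).
Proof. by rewrite -pairingB -{1}(local_rep_at X x). Qed.

(** The choice operator returns the value for some section through [X x]. The bracket term that
    differentiates [Y] sees only [X x], and the term that differentiates the section is settled by
    [pairing_diff_section]. The section [X] itself is a witness, so the default value is
    excluded. *)
Lemma bracket_pairingE k (Q : M -> {vspace 'rV[R]_n}) (U : set M) x
    (X Y : M -> 'rV[R]_n) (eta : 'cV[R]_n) :
  regular_distribution k Q -> open U -> U x -> section_of Q U X ->
  annihilates Q x eta ->
  bracket_pairing Q x eta (X x) Y = pairing eta (lie_bracket X Y x).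
Proof.
move=> Qreg oU Ux sX eQ; rewrite /bracket_pairing.
case: xgetP => [r _ [V [X' [oV Vx sX' X'x ->]]]|/(_ (pairing eta (lie_bracket X
  Y x)))].
  have E1 := pairing_lie_bracket x X' Y eta.
  have E2 := pairing_lie_bracket x X Y eta.
  have E3 := pairing_diff_section (local_rep (chart_at x) Y (cmap (chart_at x)
    x))
    Qreg oU Ux sX oV Vx sX' (esym X'x) eQ.
  apply: etrans E1 (etrans _ (esym E2)).
  exact: (congr2 (fun v r => pairing eta ('d (local_rep (chart_at x) Y)
    (cmap (chart_at x) x) v) - r) X'x (esym E3)).
by case; exists U, X.
Qed.

(** The multiplier equation is tested on vector fields defined on all of [M], so the constant field
    [e] of a chart has to be cut off and extended by 0. *)
Lemma bump_field x (e : 'rV[R]_n) : exists Y : M -> 'rV[R]_n,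
  exists f : 'rV[R]_n -> R,
  [/\ smooth_vector_field setT Y, smooth setT f, 0 < f (cmap (chart_at x) x) &
      forall q, (cmap (chart_at x) @` cdom (chart_at x)) q ->
        local_rep (chart_at x) Y q = f q *: e].
Proof.
set i0 := chart_at x; set p := cmap i0 x.
have ix : cdom i0 x := chart_atP x.
(* Half the radius of an open ball in the chart image, so that the closed ball, which is compact,
   still lies in the image. *)
have [r r0 rP] : exists2 r : R, 0 < r & forall q,
  `|p - q| <= r -> (cmap i0 @` cdom i0) q.
  have : \forall q \near p, (cmap i0 @` cdom i0) q.
    by apply: open_nbhs_nbhs; split; [exact: cimg_open|exists x].
  move=> /nbhs_ballP[r r0 H]; exists (r / 2); first by rewrite divr_gt0.
  move=> q pq; apply: H; rewrite -ball_normE /=; apply: le_lt_trans pq _.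
  by rewrite ltr_pdivrMr // ltr_pMr // ltr1n.
pose B := [set q : 'rV[R]_n | `|p - q| <= r].
pose K := cinv i0 @` B.
have cB : compact B.
  apply: bounded_closed_compact.
    exists (`|p| + r); split; first exact: num_real.
    move=> N /ltW prN q pq; rewrite /B /= in pq.
    apply: le_trans prN; rewrite -[q](subrK p).
    by apply: le_trans (ler_normD _ _) _; rewrite addrC lerD2l distrC.
  by rewrite -[B]/(closed_ball_ Num.norm p r) -closed_ballE //;
    exact: closed_ball_closed.
(* A compact subset of a Hausdorff space. Without it the extension by 0 could fail to be smooth at
   boundary points of the chart domain. *)
have cK : closed K.
  apply: (compact_closed (@carrier_hausdorff _ _ M)).
  apply: continuous_compact cB; apply: continuous_in_subspaceT => q.
  by rewrite inE => Bq; apply: cinv_continuous; exact: rP.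
pose f := bump p r.
have f0 q : ~ B q -> f q = 0.
  move=> nB; apply: bump_eq0 => //; rewrite distrC ltW // ltNge.
  by apply/negP.
pose Y y := if pselect (cdom i0 y) then dtransition i0 (chart_at y) y (f (cmap
  i0 y) *: e)
  else 0 : 'rV[R]_n.
have YE y : cdom i0 y -> Y y = dtransition i0 (chart_at y) y (f (cmap i0 y) *:
  e).
  by rewrite /Y; case: pselect.
have Y0 y : ~ K y -> Y y = 0.
  move=> nKy; rewrite /Y; case: pselect => // jy.
  have -> : f (cmap i0 y) = 0.
    by apply: f0 => By; apply: nKy; exists (cmap i0 y) => //; rewrite cmapK.
  by rewrite scale0r /dtransition linear0.
exists Y, f; split.
(* Two open sets cover [M]: the domain of the chart [i0], where the field is an explicit composition
   of smooth maps, and the complement of [K], where it is 0. *)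
- move=> i; apply: smooth_cover => q /mem_chart_img[iq _].
  have [jq|njq] := pselect (cdom i0 (cinv i q)).
    exists (cmap i @` (cdom i `&` cdom i0)); first exact/mem_chart_img.
    have oB : open (cmap i @` (cdom i `&` cdom i0)) by apply: chart_img_open;
      exact: cdom_open.
    pose t := cmap i0 \o cinv i.
    apply: (smooth_ext (f := fun q =>
      f (t q) *: 'd (cmap i \o cinv i0) (t q) e)) => //.
      move=> y /mem_chart_img[iy jy].
      rewrite /local_rep YE // /chart_coord -[LHS]linearZ.
      rewrite -[LHS]/(dtransition i0 i (cinv i y) _) -[RHS]/(dtransition _ i _
        _) dtransition_comp //.
        exact: chart_atP.
      exact: cdom_cinv.
    have st : smooth (cmap i @` (cdom i `&` cdom i0)) t :=
      @chart_compat _ _ M i i0.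
    apply: smooth_scale => //.
      apply: (smooth_comp (B := setT)) st _ => //; first exact: framed_rV.
      exact: smooth_bump.
    apply: (smooth_comp (B := cmap i0 @` (cdom i0 `&` cdom i)) (g := fun q =>
      'd (cmap i \o cinv i0) q e)) st _ => //.
    + exact: framed_rV.
    + move=> y /mem_chart_img[iy jy]; exists (cinv i y) => //; split => //;
      exact: cdom_cinv.
    + apply: smooth_diff; exact: chart_compat.
  exists (cmap i @` (cdom i `&` ~` K)).
    apply/mem_chart_img; split => // -[y By yq]; apply: njq.
    by rewrite -yq; apply: cdom_cinv; exact: rP.
  apply: (smooth_ext (f := cst 0)); last exact: smooth_cst.
    by apply: chart_img_open; exact: closed_openC.
  by move=> y /mem_chart_img[iy nKy]; rewrite /local_rep Y0 // /chart_coord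
    linear0.
- exact: smooth_bump.
- exact: bump_gt0.
- move=> q iq; have jq := cdom_cinv iq.
  by rewrite /local_rep YE // /chart_coord -[LHS]/(dtransition _ i0 _ _)
    dtransitionK ?cinvK //; exact: chart_atP.
Qed.

End Bracket.

(** * Local flows *)

Section Flow.
Context {R : realType} {n : nat} {M : manifold R n}.
Context (U : set M) (X : M -> 'rV[R]_n) (D : set (R * M)) (phi : R -> M -> M).
Context (phi_flow : local_flow U X D phi).

Lemma flow_open : open D.
Proof. by have [[oD _] _ _ _] := phi_flow. Qed.

Lemma flow_dom s x : D (s, x) -> U x.
Proof. by have [[_ DU] _ _ _] := phi_flow; exact: DU. Qed.

Lemma flow_dom0 x : U x -> D (0, x).
Proof. by have [_ H _ _ /H[]] := phi_flow. Qed.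

Lemma flow0 x : U x -> phi 0 x = x.
Proof. by have [_ H _ _ /H[]] := phi_flow. Qed.

Lemma flow_codom s x : D (s, x) -> U (phi s x).
Proof.
move=> Dsx; have [_ H _ _] := phi_flow.
by have [_ _ _ /(_ s Dsx)[]] := H x (flow_dom Dsx).
Qed.

(** The shifted curve [s |-> phi (s + r) x] is an integral curve that starts at [phi r x]; by
    maximality it is a restriction of the flow line of that point. *)
Lemma flow_add r s x : D (r, x) -> D (s + r, x) ->
  D (s, phi r x) /\ phi (s + r) x = phi s (phi r x).
Proof.
move=> Dr Ds; have Ux := flow_dom Dr.
have [_ H max _] := phi_flow; have [iJ D0 _ ic] := H x Ux.
apply: (max _ [set s | D (s + r, x)] (fun s => phi (s + r) x)) => //=.
- exact: flow_codom.
- move=> a b Ja Jb z /andP[az zb].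
  by apply: (iJ _ _ Ja Jb); rewrite !lerD2r az.
- by rewrite add0r.
- by rewrite add0r.
- exact: (@integral_curve_shift _ _ _ U X [set s | D (s, x)] (phi^~ x) r).
Qed.

Definition flow_rep (i j : chart_index M) (p : R * 'rV[R]_n) : 'rV[R]_n :=
  cmap j (phi p.1 (cinv i p.2)).

Definition flow_set (i j : chart_index M) : set (R * 'rV[R]_n) :=
  [set p | [/\ (cmap i @` cdom i) p.2, D (p.1, cinv i p.2) &
    cdom j (phi p.1 (cinv i p.2))]].

Lemma flow_continuous i p : (cmap i @` cdom i) p.2 -> D (p.1, cinv i p.2) ->
  {for p, continuous (fun p : R * 'rV[R]_n => phi p.1 (cinv i p.2))}.
Proof. by move=> ip Dp; have [_ _ _ /(_ i)[H _]] := phi_flow; exact: H. Qed.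

Lemma flow_rep_smooth i j : smooth (flow_set i j) (flow_rep i j).
Proof.
have [_ _ _ /(_ i)[_ /(_ j)]] := phi_flow; apply: smooth_sub.
by move=> p [].
Qed.

Lemma flow_set_open i j : open (flow_set i j).
Proof.
rewrite openE => p [ip Dp jp].
have n1 : \forall q \near p, (cmap i @` cdom i) q.2.
  have : snd q @[q --> p] --> p.2 by exact: cvg_snd.
  by apply; apply: open_nbhs_nbhs; split => //; exact: cimg_open.
have n2 : \forall q \near p, D (q.1, cinv i q.2).
  have : (q.1, cinv i q.2) @[q --> p] --> (p.1, cinv i p.2).
    have a1 : q.1 @[q --> p] --> p.1 by exact: cvg_fst.
    have a2 : q.2 @[q --> p] --> p.2 by exact: cvg_snd.
    have a4 : cinv i y @[y --> p.2] --> cinv i p.2 := cinv_continuous ip.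
    have a3 : cinv i q.2 @[q --> p] --> cinv i p.2 by exact: cvg_comp a2 a4.
    exact: cvg_pair a1 a3.
  by apply; apply: open_nbhs_nbhs; split => //; exact: flow_open.
have n3 : \forall q \near p, cdom j (phi q.1 (cinv i q.2)).
  by apply: (flow_continuous ip Dp); exact: near_cdom.
by near=> q; split; near: q.
Unshelve. all: by end_near. Qed.

Lemma mem_flow_set i j s x : cdom i x -> D (s, x) -> cdom j (phi s x) ->
  flow_set i j (s, cmap i x).
Proof. by move=> ix Dsx jx; split; rewrite /= ?cmapK //; exists x. Qed.

Lemma is_diff_space (s : R) (y : 'rV[R]_n) :
  is_diff y (fun y => (s, y)) (fun v => (0, v)).
Proof. exact: (is_diff_pair (is_diff_cst s y) (is_diff_id y)). Qed.

Lemma is_diff_time (s : R) (y : 'rV[R]_n) :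
  is_diff s (fun s => (s, y)) (fun h => (h, 0)).
Proof. exact: (is_diff_pair (is_diff_id s) (is_diff_cst y s)). Qed.

Lemma is_diff_flow i j s y : flow_set i j (s, y) ->
  is_diff y (cmap j \o phi s \o cinv i) (fun v => 'd (flow_rep i j) (s, y) (0,
    v)).
Proof.
move=> H; have df := smooth_differentiable (@flow_rep_smooth i j) H.
exact: (is_diff_comp (is_diff_space s y) (differentiableP df)).
Qed.

Lemma flow_continuous_at s x : D (s, x) -> {for x, continuous (phi s)}.
Proof.
move=> Dsx; set i := chart_at x; have ix : cdom i x := chart_atP x.
have c1 : phi s (cinv i (cmap i y)) @[y --> x] --> phi s x.
  have H : phi q.1 (cinv i q.2) @[q --> (s,
    cmap i x)] --> phi s (cinv i (cmap i x)).
    by apply: (@flow_continuous i (s, cmap i x)); rewrite /= ?cmapK //;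
      exists x.
  rewrite cmapK // in H.
  have a1 : cmap i y @[y --> x] --> cmap i x := cmap_continuous ix.
  have a2 : (s, cmap i y) @[y --> x] --> (s,
    cmap i x) by exact: cvg_pair (cvg_cst s) a1.
  exact: cvg_comp a2 H.
apply: cvg_trans c1; apply: near_eq_cvg.
by apply: filterS (near_cdom ix) => y iy; rewrite cmapK.
Qed.

Lemma differentiable_flow_at s x : D (s, x) ->
  differentiable (cmap (chart_at (phi s x)) \o phi s \o cinv (chart_at x))
    (cmap (chart_at x) x).
Proof.
move=> Dsx.
by case: (is_diff_flow (mem_flow_set (chart_atP x) Dsx (chart_atP (phi s x)))).
Qed.

Lemma near_flow_dom s x : D (s, x) -> \forall y \near x, D (s, y).
Proof.
move=> Dsx; have : (s, y) @[y --> x] --> (s, x).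
  exact: (cvg_pair (cvg_cst s) cvg_id).
by apply; apply: open_nbhs_nbhs; split => //; exact: flow_open.
Qed.

(** The chain rule needs the composition law on a neighbourhood of [x]; the openness of [D] provides
    it. *)
Lemma tangent_map_flow_add r s x v : D (r, x) -> D (s + r, x) ->
  tangent_map (phi (s + r)) x v =
  tangent_map (phi s) (phi r x) (tangent_map (phi r) x v).
Proof.
move=> Dr Dsr; have [Ds E] := flow_add Dr Dsr.
rewrite -(tangent_map_comp (f := phi r) (g := phi s)).
- apply: tangent_map_near_eq; last exact: differentiable_flow_at.
  apply: filterS2 (near_flow_dom Dr) (near_flow_dom Dsr) => y Dry Dsry.
  by have [] := flow_add Dry Dsry.
- exact: flow_continuous_at.
- exact: flow_continuous_at.
- exact: differentiable_flow_at.
- exact: differentiable_flow_at.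
Qed.

Lemma tangent_map0 x v : U x -> tangent_map (phi 0) x v = v.
Proof.
move=> Ux; have D0 := flow_dom0 Ux.
have -> : tangent_map (phi 0) x v = tangent_map id x v.
  apply: tangent_map_near_eq; last exact: differentiable_flow_at.
  by apply: filterS (near_flow_dom D0) => y /flow_dom/flow0.
exact: (dtransition_id v (chart_atP x)).
Qed.

Lemma flow_rep_time i y : flow_set i i (0, y) ->
  'd (flow_rep i i) (0, y) (1, 0) = local_rep i X y.
Proof.
move=> H; have [/= iy D0 _] := H; have Ux := flow_dom D0.
have df := smooth_differentiable (@flow_rep_smooth i i) H.
set x := cinv i y in D0 Ux *.
have h1 := is_diff_has_derivative setT
  (is_diff_comp (is_diff_time 0 y) (differentiableP df)).
have [_ /(_ x Ux)[iJ _ p0 ic] _ _] := phi_flow.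
have [_ hv] := ic 0 D0; rewrite p0 in hv.
have ix : cdom i (phi 0 x) by rewrite p0; exact: cdom_cinv.
have h2 := has_velocity_chart ix hv; rewrite p0 in h2.
have : \forall s \near (0 : R), D (s, x).
  have : (s, x) @[s --> (0 : R)] --> (0 : R, x).
    exact: (cvg_pair cvg_id (cvg_cst _)).
  by apply; apply: open_nbhs_nbhs; split => //; exact: flow_open.
move=> /nbhs_ballP[e e0 He].
(* One derivative is taken within the whole line, the other within the existence interval of the
   flow line. They are compared on a closed interval around 0 contained in the latter. *)
have e20 : 0 < e / 2 by rewrite divr_gt0.
apply: (@has_derivative_unique _ _ (- (e / 2)) (e / 2) _ 0 _ _ _ _
  (has_derivative_sub (@subsetT _ _) h1) (has_derivative_sub _ h2)).
- by rewrite gtrN.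
- by rewrite in_itv /= oppr_le0 ltW.
- move=> s; rewrite /= in_itv /= => /andP[s1 s2]; apply: He.
  rewrite -ball_normE /= sub0r normrN; apply: (@le_lt_trans _ _ (e / 2)).
    by rewrite ler_norml s1.
  by rewrite ltr_pdivrMr // ltr_pMr // ltr1n.
Qed.

Lemma has_derivative_diff_flow x u : U x ->
  has_derivative setT
    (fun s => 'd (cmap (chart_at x) \o phi s \o cinv (chart_at x)) (cmap
      (chart_at x) x) u)
    0 ('d (local_rep (chart_at x) X) (cmap (chart_at x) x) u).
Proof.
move=> Ux; set i := chart_at x; set p := cmap i x;
  have ix : cdom i x := chart_atP x.
have D0 := flow_dom0 Ux.
have H0 : flow_set i i (0, p) by apply: mem_flow_set => //; rewrite flow0.
have nH : \forall q \near (0 : R, p), flow_set i i q.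
  by apply: open_nbhs_nbhs; split => //; exact: flow_set_open.
have sF := @flow_rep_smooth i i.
have dF v := smooth_differentiable (smooth_diff v sF) H0.
have h1 := is_diff_has_derivative setT
  (is_diff_comp (is_diff_time 0 p) (differentiableP (dF (0, u)))).
pose G := fun q : R * 'rV[R]_n => 'd (flow_rep i i) q (1, 0).
have dG : differentiable G (0, p) := dF (1, 0).
(* At time 0 the time derivative of the flow is the field on a whole neighbourhood of [p], hence the
   space derivative of [G] there is the derivative of the field. *)
have GE : \forall y \near p, (G \o (fun y => (0, y))) y = local_rep i X y.
  have cs : (0 : R, y) @[y --> p] --> (0 : R, p).
    have a : y @[y --> p] --> p by exact: cvg_id.
    exact: cvg_pair (cvg_cst (0 : R)) a.
  have nS : \forall y \near p, flow_set i i (0, y) := cs _ nH.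
  by apply: filterS nS => y; exact: flow_rep_time.
have E2 : 'd (fun q => 'd (flow_rep i i) q (0, u)) (0, p) (1, 0) = 'd G (0,
  p) (0, u).
  exact: (schwarz _ _ (@flow_set_open i i) H0 sF).
have E1 : 'd (local_rep i X) p u = 'd G (0, p) (0, u).
  clearbody G; have dt := is_diff_comp (is_diff_space 0 p) (differentiableP dG).
  have [dd ddE] := dt.
  exact: etrans (congr1 (@^~ u) (near_eq_diff GE dd)) (congr1 (@^~ u) ddE).
have h2 : has_derivative setT
    (fun s => 'd (cmap i \o phi s \o cinv i) p u) 0
    ('d (fun q => 'd (flow_rep i i) q (0, u)) (0, p) (1, 0)).
  apply: has_derivative_ext h1.
    have cs : (s, p) @[s --> (0 : R)] --> (0 : R, p).
      exact: (cvg_pair cvg_id (cvg_cst _)).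
    have nS : \forall s \near (0 : R), flow_set i i (s, p) := cs _ nH.
    apply: filterS nS => s Hs _.
    by have [_ /(congr1 (@^~ u))] := is_diff_flow Hs.
  by have [_ /(congr1 (@^~ u))] := is_diff_flow H0.
exact: (eq_ind _ (fun v => has_derivative setT _ 0 v) h2 _ (etrans E2 (esym
  E1))).
Qed.

(** The vector [tangent_map (phi s) x u] is written in the chart chosen at [phi s x], which varies
    with [s] without any regularity. On the right-hand side everything is read in the chart at [x],
    where differentiation in [s] makes sense. *)
Lemma pairing_tangent_flow s x (alpha : 'cV[R]_n) u :
  D (s, x) -> cdom (chart_at x) (phi s x) ->
  pairing alpha (tangent_map (phi s) x u) =
  pairing (chart_cocoord (chart_at x) (phi s x) alpha)
    ('d (cmap (chart_at x) \o phi s \o cinv (chart_at x)) (cmap (chart_at x) x)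
      u).
Proof.
move=> Dsx; set i := chart_at x => iy; have ix : cdom i x := chart_atP x.
rewrite pairing_cocoord; congr pairing.
have [dd _] := is_diff_flow (mem_flow_set ix Dsx iy).
have cf : {for cmap i x, continuous (phi s \o cinv i)}.
  have c1 : phi s y @[y --> x] --> phi s x := flow_continuous_at Dsx.
  have c2 : phi s (cinv i y) @[y --> cmap i x] -->
    phi s x by exact: cvg_comp (cinv_cvg ix) c1.
  by rewrite /prop_for /continuous_at /= cmapK.
have xE : (phi s \o cinv i) (cmap i x) = phi s x by rewrite /= cmapK.
have i1 : cdom i ((phi s \o cinv i) (cmap i x)) by rewrite xE.
have j1 : cdom (chart_at (phi s x)) ((phi s \o cinv i) (cmap i x)).
  by rewrite xE; exact: chart_atP.
have [_ /(congr1 (@^~ u)) E] :=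
  is_diff_chart_codom cf i1 j1 (differentiableP dd).
rewrite xE in E; exact: E.
Qed.

End Flow.

(** * Covectors along an integral curve *)

Section Extremal.
Context {R : realType} {n k : nat} {M : manifold R n}.
Context (Q : M -> {vspace 'rV[R]_n}) (a b : R) (c : R -> M) (U : set M)
  (X : M -> 'rV[R]_n) (D : set (R * M)) (phi : R -> M -> M).
Context (Q_regular : regular_distribution k Q) (ab : a < b)
  (U_open : open U) (X_section : section_of Q U X)
  (c_integral : integral_curve U X `[a, b] c)
  (phi_flow : local_flow U X D phi).

Lemma curve_dom t : t \in `[a, b] -> U (c t).
Proof. by move=> tab; have [] := c_integral tab. Qed.

Lemma curve_velocity t : t \in `[a, b] -> has_velocity `[a, b] c t (X (c t)).
Proof. by move=> tab; have [] := c_integral tab. Qed.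

Lemma curve_velocity_unique t v : t \in `[a, b] -> has_velocity `[a, b] c t v ->
  v = X (c t).
Proof.
by move=> tab [_ hv]; have [_ hX] := curve_velocity tab;
  exact: has_derivative_unique ab tab hv hX.
Qed.

(** Maximality of the flow, applied to [c] shifted so that [c s] is its value at 0. There is no
    order between [s] and [t]: the flow is also followed backwards. *)
Lemma curve_flow s t : s \in `[a, b] -> t \in `[a, b] ->
  D (t - s, c s) /\ c t = phi (t - s) (c s).
Proof.
move=> sab tab; have [_ _ max _] := phi_flow.
pose J := [set r | r + s \in `[a, b]].
have iJ : is_interval J.
  move=> x y; rewrite /J /= !in_itv /= =>
    /andP[x1 x2] /andP[y1 y2] z /andP[xz zy].
  by apply/andP; split; [apply: le_trans x1 _|apply: le_trans _ y2];
    rewrite lerD2r.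
have J0 : J 0 by rewrite /J /= add0r.
have ic : integral_curve U X J (fun r => c (r + s)).
  exact: (@integral_curve_shift _ _ _ U X [set` `[a, b]] c s).
have := max (c s) J (fun r => c (r + s)) (curve_dom sab) iJ J0 _ ic (t - s).
by rewrite add0r /J /= subrK; apply.
Qed.

Lemma near_curve_cdom t : t \in `[a, b] ->
  \forall s \near t, s \in `[a, b] -> cdom (chart_at (c t)) (c s).
Proof.
move=> tab; have [cc _] := curve_velocity tab.
have : \forall s \near within `[a, b] (nbhs t), cdom (chart_at (c t)) (c s).
  exact: (cc _ (near_cdom (chart_atP (c t)))).
by rewrite near_withinE.
Qed.

Lemma has_derivative_chart_curve t : t \in `[a, b] ->
  has_derivative `[a, b] (cmap (chart_at (c t)) \o c) t (X (c t)).
Proof.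
move=> tab; have := has_velocity_chart (chart_atP (c t)) (curve_velocity tab).
by rewrite chart_coord_id.
Qed.

(** The map T phi_(s-t) at [c t] with both source and target in the chart at [c t]; it has this
    meaning for [s] close to [t]. *)
Definition flow_diff t (s : R) (u : 'rV[R]_n) : 'rV[R]_n :=
  'd (cmap (chart_at (c t)) \o phi (s - t) \o cinv (chart_at (c t)))
    (cmap (chart_at (c t)) (c t)) u.

Lemma flow_diff0 t u : t \in `[a, b] -> flow_diff t t u = u.
Proof.
move=> tab; rewrite /flow_diff subrr.
have := tangent_map0 phi_flow u (curve_dom tab).
by rewrite /tangent_map (flow0 phi_flow (curve_dom tab)).
Qed.

Lemma has_derivative_flow_diff t u : t \in `[a, b] ->
  has_derivative `[a, b] (fun s => flow_diff t s u) t
    ('d (local_rep (chart_at (c t)) X) (cmap (chart_at (c t)) (c t)) u).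
Proof.
move=> tab.
have h := has_derivative_diff_flow (u := u) phi_flow (curve_dom tab).
have {}h : has_derivative setT (fun s => 'd (cmap (chart_at (c t)) \o phi s \o
    cinv (chart_at (c t))) (cmap (chart_at (c t)) (c t)) u) (t + - t)
    ('d (local_rep (chart_at (c t)) X) (cmap (chart_at (c t)) (c t)) u).
  by rewrite subrr.
by apply: has_derivative_sub (has_derivative_shift h).
Qed.

Lemma pairing_flow_diff t s (alpha : 'cV[R]_n) u :
  t \in `[a, b] -> s \in `[a, b] -> cdom (chart_at (c t)) (c s) ->
  pairing alpha (tangent_map (phi (s - t)) (c t) u) =
  pairing (chart_cocoord (chart_at (c t)) (c s) alpha) (flow_diff t s u).
Proof.
move=> tab sab; have [Dst cE] := curve_flow tab sab; rewrite cE => i.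
exact: (pairing_tangent_flow phi_flow).
Qed.

Lemma tangent_map_curve_add r s t v :
  r \in `[a, b] -> s \in `[a, b] -> t \in `[a, b] ->
  tangent_map (phi (t - r)) (c r) v =
  tangent_map (phi (t - s)) (c s) (tangent_map (phi (s - r)) (c r) v).
Proof.
move=> rab sab tab; have [D1 ->] := curve_flow rab sab.
have [D2 _] := curve_flow rab tab.
have E : t - r = (t - s) + (s - r) by rewrite addrA subrK.
by rewrite {1}E (tangent_map_flow_add phi_flow) // -E.
Qed.

Lemma pairing_local_rep t s (alpha : 'cV[R]_n) (Y : M -> 'rV[R]_n) :
  cdom (chart_at (c t)) (c s) ->
  pairing alpha (Y (c s)) = pairing (chart_cocoord (chart_at (c t)) (c s) alpha)
    (local_rep (chart_at (c t)) Y (cmap (chart_at (c t)) (c s))).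
Proof. by move=> i; rewrite local_repE // pairing_chart. Qed.

(* The multiplier equation for Y = f e_j with f > 0 near c t, divided by f. *)
Lemma cocoord_has_derivative (psi : R -> 'cV[R]_n) t j : t \in `[a, b] ->
  annihilates Q (c t) (psi t) ->
  (forall Y, smooth_vector_field setT Y ->
    has_derivative `[a, b] (fun s => pairing (psi s) (Y (c s))) t
      (bracket_pairing Q (c t) (psi t) (X (c t)) Y)) ->
  has_derivative `[a, b]
    (fun s => chart_cocoord (chart_at (c t)) (c s) (psi s) j 0 : R) t
    (- pairing (psi t)
      ('d (local_rep (chart_at (c t)) X) (cmap (chart_at (c t)) (c t))
        (delta_mx 0 j))).
Proof.
move=> tab psiQ psiE; set x := c t; set i := chart_at x; set p := cmap i x.
pose e : 'rV[R]_n := delta_mx 0 j; rewrite -/e.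
have ix : cdom i x := chart_atP x.
have [Y [f [sY sf f0 YE]]] := bump_field x e; rewrite -/i -/p in f0 YE.
have np : \forall q \near p, (cmap i @` cdom i) q.
  by apply: open_nbhs_nbhs; split; [exact: cimg_open|exists x].
have df : differentiable f p by exact: smooth_differentiable sf I.
have Yp : local_rep i Y p = f p *: e by apply: YE; exact: nbhs_singleton np.
have dY w : 'd (local_rep i Y) p w = 'd f p w *: e.
  have E : \forall q \near p, (fun q => f q *: e) q = local_rep i Y q.
    by apply: filterS np => q iq; rewrite YE.
  have E1 := congr1 (@^~ w) (near_eq_diff E (differentiableZl e df)).
  exact: etrans E1 (congr1 (@^~ w) (diffZl e df)).
have dq := has_derivative_chart_curve tab.
have dF := has_derivative_comp (differentiableP df) dq.
set d := 'd (local_rep i X) p e.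
(* In the chart [X, f e] = (Xf) e - f DX(e), as [e] is constant, and the pairing of psi with Y is
   [f] times the entry [j]. After division by [f] the terms that contain the derivative of [f]
   cancel. *)
have hP : has_derivative `[a, b] ((f \o (cmap i \o c)) * (fun s =>
    chart_cocoord i (c s) (psi s) j 0 : R)) t
    ('d f p (X x) * psi t j 0 - f p * pairing (psi t) d).
  have hY := psiE Y sY.
  have V : bracket_pairing Q (c t) (psi t) (X (c t)) Y =
      'd f p (X x) * psi t j 0 - f p * pairing (psi t) d.
    have E1 := bracket_pairingE Y Q_regular U_open (curve_dom tab) X_section
      psiQ.
    apply: etrans E1 (etrans (pairing_lie_bracket x X Y (psi t)) _).
    congr (_ - _).
      by apply: etrans (congr1 (pairing (psi t)) (dY (X x))) _;
        rewrite pairingZ pairing_delta.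
    rewrite -[RHS]pairingZ; congr pairing.
    exact: etrans (congr1 _ Yp) (linearZ _ _).
  have {}hY := eq_ind _ (fun v => has_derivative _ _ _ v) hY _ V.
  apply: has_derivative_ext hY.
    apply: filterS (near_curve_cdom tab) => s H sab; have is_ := H sab.
    rewrite (pairing_local_rep _ _ is_) YE; last by exists (c s).
    by rewrite pairingZ pairing_delta.
  rewrite (pairing_local_rep _ _ ix) YE; last by exists (c t).
  by rewrite pairingZ pairing_delta.
have F0 : (f \o (cmap i \o c)) t != 0 by rewrite /= gt_eqF.
have tJ : [set` `[a, b]] t by [].
have hE := has_derivative_factor tJ dF F0 hP.
apply: eq_ind _ (fun v => has_derivative _ _ _ v) hE _ _.
have -> : chart_cocoord i (c t) (psi t) = psi t by exact: chart_cocoord_id.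
rewrite /= -/p; move: ('d f p (X x)) (pairing _ d) => A B.
by field; rewrite gt_eqF.
Qed.

Lemma multiplier_transport (psi : R -> 'cV[R]_n) :
  (forall t, t \in `[a, b] -> annihilates Q (c t) (psi t)) ->
  (forall Y, smooth_vector_field setT Y -> forall t, t \in `[a, b] ->
    has_derivative `[a, b] (fun s => pairing (psi s) (Y (c s))) t
      (bracket_pairing Q (c t) (psi t) (X (c t)) Y)) ->
  forall t, t \in `[a, b] -> psi t =
    cotangent_map (phi (- (t - a))) (c t) (psi a).
Proof.
move=> psiQ psiE T Tab; apply: pairing_inj => v.
rewrite pairing_cotangent_map opprB.
(* The end time [T] is fixed and the vector [v] at [c T] is carried to all other times. The value at
   [T] is <psi(T), v>; the value at [a] is the pairing of [v] with the transported covector. *)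
pose g t := pairing (psi t) (tangent_map (phi (t - T)) (c T) v).
have gT : g T = pairing (psi T) v.
  by rewrite /g subrr (tangent_map0 phi_flow) //; exact: curve_dom.
have aab : a \in `[a, b] by rewrite in_itv /= lexx ltW.
rewrite -gT; apply: (has_derivative0_cst _ Tab aab) => t tab.
(* By the composition law T phi_(s-T) v = T phi_(s-t) u, so the derivative of [g] at any [t]
   involves only the flow at times near 0. *)
set i := chart_at (c t); pose u := tangent_map (phi (t - T)) (c T) v.
pose E s := chart_cocoord i (c s) (psi s).
set dX := 'd (local_rep i X) (cmap i (c t)).
have hE j : has_derivative `[a, b] (fun s => E s j 0 : R) t
    ((\col_l - pairing (psi t) (dX (delta_mx 0 l))) j 0).
  rewrite mxE; apply: cocoord_has_derivative (psiQ _ tab) _ => // Y sY.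
  exact: psiE.
have h := has_derivative_pairing_coord hE (has_derivative_flow_diff (u :=
  u) tab).
have V : pairing (\col_l - pairing (psi t) (dX (delta_mx 0 l))) (flow_diff t t
  u)
    + pairing (E t) (dX u) = 0.
  rewrite flow_diff0 // /E chart_cocoord_id.
  have -> : \col_l - pairing (psi t) (dX (delta_mx 0 l)) =
      - \col_l pairing (psi t) (dX (delta_mx 0 l)).
    by apply/colP => l; rewrite !mxE.
  rewrite {1}/pairing mulmxN mxE -[X in - X + _]/(pairing _ _)
    pairing_col_linear.
  by rewrite addNr.
have {}h := eq_ind _ (fun v => has_derivative _ _ _ v) h _ V.
have gE s : s \in `[a, b] -> cdom i (c s) -> pairing (E s) (flow_diff t s u) =
  g s.
  move=> sab is_; rewrite /E -pairing_flow_diff // /u.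
  by rewrite -tangent_map_curve_add.
apply: has_derivative_ext h; last by apply: gE => //; exact: chart_atP.
by apply: filterS (near_curve_cdom tab) => s H sab; apply: gE => //; exact: H.
Qed.

(** The smoothness of [eta] provides a derivative of its components, and the invariance determines
    its value. The bracket is the one with [X] itself. *)
Lemma transport_has_derivative (eta : R -> 'cV[R]_n) (Y : M -> 'rV[R]_n) t :
  smooth_cotangent_curve c eta a b ->
  (forall s, s \in `[a, b] -> eta s =
    cotangent_map (phi (- (s - a))) (c s) (eta a)) ->
  smooth_vector_field setT Y -> t \in `[a, b] ->
  has_derivative `[a, b] (fun s => pairing (eta s) (Y (c s))) t
    (pairing (eta t) (lie_bracket X Y (c t))).
Proof.
move=> [e e0 [c' [eta' [[_ /(_ (chart_at (c t))) sE] cE etaE]]]] etaT sY tab.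
set x := c t; set i := chart_at x in sE; set p := cmap i x.
have ix : cdom i x := chart_atP x.
have aab : a \in `[a, b] by rewrite in_itv /= lexx ltW.
pose E s := chart_cocoord i (c s) (eta s).
set dX := 'd (local_rep i X) p.
have dE : differentiable (fun s => chart_cocoord i (c' s) (eta' s)) t.
  apply: smooth_differentiable sE _; split; last by rewrite /= cE.
  move: tab; rewrite /= !in_itv /= => /andP[at_ tb].
  by rewrite (lt_le_trans _ at_) ?(le_lt_trans tb) // ?ltrDl // ltrBlDr ltrDl.
have hE : has_derivative `[a, b] E t ('d (fun s =>
  chart_cocoord i (c' s) (eta' s)) t 1).
  have := is_diff_has_derivative `[a, b] (differentiableP dE).
  apply: has_derivative_ext; last by rewrite /E cE // etaE.
  by apply: (@filterE _ (nbhs t)) => s sab; rewrite /E cE // etaE.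
move: hE; set E' := 'd _ t 1 => hE.
(* The adjoint equation. The function s |-> <eta(s), T phi_(s-t) u> has the constant value <eta(a),
   T phi_(a-t) u>, and its derivative at [t] is also given by the Leibniz rule. *)
have adj u : pairing E' u = - pairing (eta t) (dX u).
  have h1 := has_derivative_pairing hE (has_derivative_flow_diff (u := u) tab).
  have h2 : has_derivative `[a, b] (fun s =>
    pairing (E s) (flow_diff t s u)) t 0.
    have gE s : s \in `[a, b] -> cdom i (c s) ->
        pairing (eta a) (tangent_map (phi (a - t)) x u) =
        pairing (E s) (flow_diff t s u).
      move=> sab is_; apply: etrans _ (pairing_flow_diff (eta s) u tab sab is_).
      rewrite [in RHS](etaT s sab) pairing_cotangent_map opprB.
      by congr pairing; exact: tangent_map_curve_add.
    apply: has_derivative_ext (has_derivative_cst _ (pairing (eta a)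
      (tangent_map (phi (a - t)) x u)) t); last exact: gE.
    by apply: filterS (near_curve_cdom tab) => s H sab; apply: gE => //;
      exact: H.
  have := has_derivative_unique ab tab h1 h2.
  rewrite flow_diff0 // /E chart_cocoord_id => /eqP.
  by rewrite addr_eq0 => /eqP.
have dY : differentiable (local_rep i Y) p by exact: (differentiable_local_rep
  sY ix I).
have hY := has_derivative_comp (differentiableP dY) (has_derivative_chart_curve
  tab).
have h := has_derivative_pairing hE hY.
have V : pairing E' (local_rep i Y p) + pairing (E t) ('d (local_rep i Y) p (X
  x))
    = pairing (eta t) (lie_bracket X Y x).
  have E1 := pairing_lie_bracket x X Y (eta t).
  apply: etrans _ (esym E1); rewrite adj /E chart_cocoord_id addrC.
  by [].
have {}h := eq_ind _ (fun v => has_derivative _ _ _ v) h _ V.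
apply: has_derivative_ext h; last by rewrite [RHS](pairing_local_rep _ _ ix).
apply: filterS (near_curve_cdom tab) => s H sab.
by rewrite [RHS](pairing_local_rep _ _ (H sab)).
Qed.

(** A smooth curve on [a, b] must extend to a larger open interval. The domain of the flow is open
    at the times 0 and [b - a] over [c a], and the times in between belong to it since they form an
    interval. *)
Lemma flow_extends : exists2 e : R, 0 < e &
  forall t, t \in `]a - e, b + e[ -> D (t - a, c a).
Proof.
have aab : a \in `[a, b] by rewrite in_itv /= lexx ltW.
have bab : b \in `[a, b] by rewrite in_itv /= lexx ltW.
have near_dom s : D (s, c a) -> exists2 e : R, 0 < e & forall r,
  `|s - r| < e -> D (r, c a).
  move=> Ds; have cs : (r, c a) @[r --> s] --> (s, c a).
    exact: (cvg_pair cvg_id (cvg_cst _)).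
  have nD : nbhs (s, c a) D.
    by apply: open_nbhs_nbhs; split => //; exact: (flow_open phi_flow).
  have /nbhs_ballP[e e0 He] : \forall r \near s, D (r, c a) := cs _ nD.
  by exists e => // r sr; apply: He; rewrite -ball_normE.
have [D0 _] := curve_flow aab aab; have [D1 _] := curve_flow aab bab.
rewrite subrr in D0.
have [e0 e0p H0] := near_dom _ D0; have [e1 e1p H1] := near_dom _ D1.
(* Halved so that the times [- (e0 / 2)] and [b - a + e1 / 2] lie in the domain themselves and can
   bound the interval. *)
pose e := Num.min (e0 / 2) (e1 / 2).
have e_p : 0 < e by rewrite lt_min !divr_gt0.
exists e => // t; rewrite in_itv /= => /andP[ta tb].
have [_ /(_ (c a) (curve_dom aab))[iJ _ _ _] _ _] := phi_flow.
have ee0 : e <= e0 / 2 by rewrite ge_min lexx.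
have ee1 : e <= e1 / 2 by rewrite ge_min lexx orbT.
apply: (iJ (- (e0 / 2)) (b - a + e1 / 2)) => /=.
- by apply: H0; rewrite sub0r opprK gtr0_norm ?divr_gt0 // ltr_pdivrMr //
  ltr_pMr // ltr1n.
- apply: H1; rewrite opprD addrA subrr sub0r normrN gtr0_norm ?divr_gt0 //.
  by rewrite ltr_pdivrMr // ltr_pMr // ltr1n.
- apply/andP; split; lra.
Qed.

(** The transport formula, with [c] continued by the flow line of [c a], defines the extension. It
    involves the flow from [c' t] back to the fixed point [c a], hence one fixed target chart, and
    its entries are derivatives of the smooth map [flow_rep] along a smooth curve of times and
    points. *)
Lemma transport_smooth (psi : R -> 'cV[R]_n) (alpha : 'cV[R]_n) :
  (forall t, t \in `[a, b] -> psi t =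
    cotangent_map (phi (- (t - a))) (c t) alpha) ->
  smooth_cotangent_curve c psi a b.
Proof.
move=> psiE; have [e e0 De] := flow_extends.
have aab : a \in `[a, b] by rewrite in_itv /= lexx ltW.
pose x0 := c a; pose i0 := chart_at x0; pose p0 := cmap i0 x0.
have i0x : cdom i0 x0 := chart_atP x0.
pose c' t := phi (t - a) x0.
pose psi' t := cotangent_map (phi (- (t - a))) (c' t) alpha.
pose A := [set` `]a - e, b + e[].
have oA : open A by exact: interval_open.
have cc t : A t -> {for t, continuous c'}.
  move=> At; have c1 : (s - a, p0) @[s --> t] --> (t - a, p0).
    have a1 : s - a @[s --> t] --> t - a by apply: cvgB;
      [exact: cvg_id|exact: cvg_cst].
    exact: cvg_pair a1 (cvg_cst p0).
  have c2 : phi q.1 (cinv i0 q.2) @[q --> (t - a,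
    p0)] --> phi (t - a) (cinv i0 p0).
    apply: (flow_continuous phi_flow (i := i0) (p := (t - a, p0)));
      first by exists x0.
    by rewrite /= /p0 cmapK //; exact: De.
  have c3 : phi (s - a) (cinv i0 p0) @[s --> t] --> phi (t - a) (cinv i0 p0).
    exact: cvg_comp c1 c2.
  by rewrite /p0 cmapK // in c3.
have oAj j : open (A `&` c' @^-1` cdom j).
  rewrite openE => t [At jt].
  have n1 : \forall s \near t, A s by exact: open_nbhs_nbhs.
  have n2 : \forall s \near t, cdom j (c' s) := cc t At _ (near_cdom jt).
  by apply: filterS2 n1 n2.
have sid (B : set R) : smooth B (@id R).
  by apply: (@smooth_linear _ _ _ _ idfun) => x.
have sc j : smooth (A `&` c' @^-1` cdom j) (cmap j \o c').
  apply: (smooth_ext (f := flow_rep phi i0 j \o (fun t => (t - a, p0)))) => //.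
    by move=> t _; rewrite /= /flow_rep /= /p0 cmapK.
  apply: (smooth_comp (B := flow_set D phi i0 j)) => //.
  - exact: framed_prod_rV.
  - by move=> t [At jt]; apply: mem_flow_set => //; exact: De.
  - apply: smooth_pair => //; last exact: smooth_cst.
    by apply: smoothB => //; exact: smooth_cst.
  - exact: (flow_rep_smooth phi_flow).
exists e => //; exists c', psi'; split; last 2 first.
- by move=> t tab; have [_ ->] := curve_flow aab tab.
- move=> t tab; have [_ E] := curve_flow aab tab.
  by rewrite /psi' /c' /x0 -E; apply/esym/psiE.
split; first by split.
move=> j.
(* Outside [a, b] the return to [c a] cannot be deduced from [c]; it follows from the composition
   law of the flow. *)
have back t : A t -> D (- (t - a), c' t) /\ phi (- (t - a)) (c' t) = x0.
  move=> At; have [|Dm <-] := flow_add phi_flow (De t At) (s := - (t - a)).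
    by rewrite addNr; apply: (flow_dom0 phi_flow); exact: curve_dom.
  by split => //; rewrite addNr (flow0 phi_flow) //; exact: curve_dom.
have mem t : A t -> cdom j (c' t) -> flow_set D phi j i0 (- (t - a),
  cmap j (c' t)).
  by move=> At jt; have [Dt xE] := back t At; apply: mem_flow_set => //;
    rewrite xE.
apply: smooth_mx => // l l'.
(* The image under the backward flow of the coordinate vector [l] of the chart [j] at [c' t], read
   at [c a]. Pairing it with [alpha] gives the entry [l] of the covector in the chart [j]. *)
pose h t := 'd (flow_rep phi j i0) (- (t - a), cmap j (c' t)) (0, delta_mx 0 l).
have sh : smooth (A `&` c' @^-1` cdom j) h.
  apply: (smooth_comp (B := flow_set D phi j i0)
    (f := fun t => (- (t - a), cmap j (c' t)))
    (g := fun q => 'd (flow_rep phi j i0) q (0, delta_mx 0 l))) => //.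
  - exact: framed_prod_rV.
  - by move=> t [At jt]; exact: mem.
  - apply: smooth_pair => //.
    apply: (smooth_ext (f := fun t => a - t)) => //; first by move=> t _;
      rewrite opprB.
    by apply: smoothB => //; exact: smooth_cst.
  - by apply: smooth_diff; exact: (flow_rep_smooth phi_flow).
apply: (smooth_ext (f := fun t => \sum_m alpha m 0 *: (h t 0 m : R))) => //;
  last first.
  apply: smooth_sum => // m; apply: smooth_scale => //; first exact: smooth_cst.
  exact: smooth_coord.
move=> t [At jt]; rewrite (ord1 l').
have [Dt xE] := back t At.
transitivity (pairing alpha (h t)).
  by rewrite pairingE; apply: eq_bigr => m _; rewrite [LHS]mulrC.
rewrite -[RHS]pairing_delta pairing_cocoord /psi' pairing_cotangent_map;
  congr pairing.
have [dd ddE] := is_diff_flow phi_flow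
  (mem_flow_set (chart_atP (c' t)) Dt (chart_atP (phi (- (t - a)) (c' t)))).
have [_ E1] := is_diff_flow phi_flow (mem t At jt).
(* The tangent map starts in the chart chosen at [c' t]; composed with the coordinate change from
   [j] it becomes the derivative of the flow read from [j]. *)
have [_ E2] := is_diff_chart_dom (chart_atP (c' t)) jt (differentiableP dd).
rewrite /tangent_map xE in E2 *.
apply: etrans (esym (congr1 (@^~ _) E1)) (congr1 (@^~ _) E2).
Qed.

End Extremal.

(** * Abnormal extremals and flow-invariant covectors *)

Theorem proposition23 (R : realType) (n k : nat) (M : manifold R n)
    (Q : M -> {vspace 'rV[R]_n})
    (Q_regular : regular_distribution k Q) (Q_nonintegrable : ~ integrable_distribution k Q)
    (a b : R) (ab : a < b) (c : R -> M)
    (c_smooth : smooth_curve a b c)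
    (c_immersed : forall t v, t \in `[a, b] -> has_velocity `[a, b] c t v -> v != 0)
    (c_tangent : tangent_to Q a b c)
    (U : set M) (U_open : open U)
    (X : M -> 'rV[R]_n) (X_section : section_of Q U X)
    (c_integral : integral_curve U X `[a, b] c)
    (D : set (R * M)) (phi : R -> M -> M) (phi_flow : local_flow U X D phi) :
  abnormal_extremal Q a b c <->
  exists eta : R -> 'cV[R]_n,
    [/\ smooth_cotangent_curve c eta a b,
        forall t, t \in `[a, b] -> annihilates Q (c t) (eta t),
        forall t, t \in `[a, b] -> eta t != 0 &
        forall t, t \in `[a, b] ->
          eta t = cotangent_map (phi (- (t - a))) (c t) (eta a)].
Proof.
have velocity t : t \in `[a, b] -> has_velocity `[a, b] c t (X (c t)).
  exact: (curve_velocity c_integral).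
(* The subdivision has the single interval [a, b], so its list of right end points is [[:: b]]. *)
have one_piece (P : R -> R -> Prop) : P a b -> piecewise P a b.
  move=> Pab; exists [:: b]; first by split; rewrite /= ?ab.
  by case.
split=> [[_ _ [psi [_ psi0 psiQ psiE]]]|[eta [eta_smooth etaQ eta0 etaT]]].
  have psiT := multiplier_transport Q_regular ab U_open X_section c_integral
    phi_flow psiQ
    (fun Y sY t tab => psiE Y sY t _ tab (velocity t tab)).
  (* The multiplier itself is the section: the transport formula makes it smooth on the whole of
     [a, b], across the break points of its definition. *)
  exists psi; split => //.
  exact: (transport_smooth ab c_integral phi_flow psiT).
split=> //; first exact: one_piece.
exists eta; split => //; first exact: one_piece.
(* Velocities are given by a relation; by uniqueness the only one at [t] is [X (c t)], so the
   pairing can be computed with the section [X]. *)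
move=> Y sY t v tab /(curve_velocity_unique ab c_integral tab) ->.
have E := bracket_pairingE Y Q_regular U_open (curve_dom c_integral tab)
  X_section (etaQ t tab).
have h := transport_has_derivative ab c_integral phi_flow eta_smooth etaT sY
  tab.
exact: (eq_ind _ (fun r => has_derivative _ _ _ r) h _ (esym E)).
Qed.
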